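(* Let $n\ge 2$ and consider the system in the state $(r_\theta,v,r_\zeta)\in\mathbb{R}^{n-1}\times\mathbb{R}^n\times\mathbb{R}^{n-1}$ $$\begin{aligned}\dot r_\theta &= R_\theta r_\theta + R_{\theta V}V + d_\theta,\\ \tau_v\dot v &= R_{v\theta}r_\theta + (R_{vV}-\beta I_n)V + R_{v\zeta}r_\zeta - \rho(v)v + d_v,\\ \varepsilon\dot r_\zeta &= R_{\zeta\theta}r_\theta + R_{\zeta V}V + R_\zeta r_\zeta + d_\zeta,\end{aligned}\qquad V = V_\star+\Delta\,\boldsymbol{\tanh}(\Delta^{-1}v),\quad \varepsilon=\tau_d/\tau_v,$$ where all matrices, vectors and functions are those defined in the context. Define $$R_{v\theta}^{\rm new}=R_{v\theta}-R_{v\zeta}R_\zeta^{-1}R_{\zeta\theta},\qquad R_{vV}^{\rm new}=R_{vV}-R_{v\zeta}R_\zeta^{-1}R_{\zeta V}.$$ Suppose that there exist a symmetric matrix $\mathcal{P}_\theta\in\mathbb{R}^{(n-1)\times(n-1)}$ and a diagonal matrix $\mathcal{D}_v\in\mathbb{R}^{n\times n}$ such that $$\mathcal{P}_\theta\succ 0,\qquad \mathcal{D}_v\succ 0,\qquad \mathcal{Q}+\mathcal{Q}^\top\prec 0,\qquad\text{where}\quad \mathcal{Q}=\begin{bmatrix}\mathcal{P}_\theta R_\theta & \mathcal{P}_\theta R_{\theta V}\\ \mathcal{D}_vR_{v\theta}^{\rm new} & \mathcal{D}_v(R_{vV}^{\rm new}-\beta I_n)\end{bmatrix}.$$ Then there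 exists $\varepsilon^\star>0$ such that for all $\tau_d>0$ with $\tau_d<\varepsilon^\star\tau_v$ (all other parameters being fixed), the steady state (equilibrium point) $(\bar r_\theta,\bar v,\bar r_\zeta)$ of the system is exponentially stable.
   Context: **Communication graph.** $\mathcal{L}\in\mathbb{R}^{n\times n}$ is the Laplacian $\mathcal{L}=\mathcal{D}-\mathcal{A}$ of an undirected connected graph on $\{1,\dots,n\}$ with adjacency matrix $\mathcal{A}=[a_{ij}]$, where $a_{ij}=a_{ji}=1$ if $i,j$ are neighbors and $a_{ij}=a_{ji}=0$ otherwise, and $\mathcal{D}=\mathrm{diag}(\sum_j a_{ij})$. **Parameters.** $\tau_v,\tau_d,\beta,k>0$ and $\omega_{\rm nom}\in\mathbb{R}$ are scalars; $m=\mathrm{diag}(m_1^\omega,\dots,m_n^\omega)$ with $m_i^\omega>0$; $S=\mathrm{diag}(S_1^{\rm rated},\dots,S_n^{\rm rated})$ with $S_i^{\rm rated}>0$. For voltage limits $0<V_i^{\min}<V_i^{\max}$, put $V_i^\star=\tfrac12(V_i^{\max}+V_i^{\min})$, $\Delta_i=\tfrac12(V_i^{\max}-V_i^{\min})$, $V_\star=\mathrm{col}(V_1^\star,\dots,V_n^\star)$, $[V_\star]=\mathrm{diag}(V_1^\star,\dots,V_n^\star)$, $\Delta=\mathrm{diag}(\Delta_1,\dots,\Delta_n)$. $\boldsymbol{\tanh}$ is $\tanh$ applied entrywise. $\mathcal{K}=(I_n+k\mathcal{L})^{-1}$. **Leakage.** $\rho(v)=\mathrm{diag}(\rho_1(v_1),\dots,\rho_n(v_n))$,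 where $\rho_i(v_i)=|v_i/\Delta_i|-3$ if $|v_i|>3\Delta_i$ and $\rho_i(v_i)=0$ otherwise. **Linearized power flow.** $J_\theta^P,J_V^P,J_\theta^Q,J_V^Q\in\mathbb{R}^{n\times n}$ and $w_P,w_Q\in\mathbb{R}^n$ are the constant coefficients of the linear power flow model $P=J_\theta^P\theta+J_V^PV+w_P$, $Q=J_\theta^Q\theta+J_V^QV+w_Q$; it is assumed that $J_\theta^P1_n=J_\theta^Q1_n=0_n$, where $1_n$ is the all-ones vector and $0_n$ the zero vector. **Coordinate matrices.** $T\in\mathbb{R}^{n\times n}$ is the invertible matrix whose first row is $(1/n,\dots,1/n)$ and whose $(i+1)$-th row, $i=1,\dots,n-1$, has $-1$ in column $i$, $1$ in column $i+1$, and zeros elsewhere. $I_r=[0_{n-1}\ \ I_{n-1}]\in\mathbb{R}^{(n-1)\times n}$. **Components of the system.** $R_\theta=-I_rTmS^{-1}J_\theta^PT^{-1}I_r^\top$, $R_{\theta V}=-I_rTmS^{-1}J_V^P$, $R_{v\theta}=[V_\star](\mathcal{K}-I_n)S^{-1}J_\theta^QT^{-1}I_r^\top$, $R_{vV}=[V_\star](\mathcal{K}-I_n)S^{-1}J_V^Q$, $R_{v\zeta}=-[V_\star]\mathcal{K}\mathcal{L}T^{-1}I_r^\top$, $R_{\zeta\theta}=\tau_v^{-1}I_rT\mathcal{L}\mathcal{K}S^{-1}J_\theta^QT^{-1}I_r^\top$, $R_{\zeta V}=\tau_v^{-1}I_rT\mathcal{L}\mathcal{K}S^{-1}J_V^Q$,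 $R_\zeta=-\tau_v^{-1}I_rT\mathcal{L}\mathcal{K}\mathcal{L}T^{-1}I_r^\top$ (this matrix is invertible), $d_\theta=\omega_{\rm nom}I_rT1_n-I_rTmS^{-1}w_P$, $d_v=\beta V_\star+[V_\star](\mathcal{K}-I_n)S^{-1}w_Q$, $d_\zeta=\tau_v^{-1}I_rT\mathcal{L}\mathcal{K}S^{-1}w_Q$. $\succ 0$ and $\prec 0$ denote positive and negative definiteness of symmetric matrices. ''Exponentially stable'' is in the standard sense for an equilibrium of an autonomous ODE: there are constants $c,\gamma,r>0$ such that every solution starting within distance $r$ of the equilibrium satisfies $\|x(t)-\bar x\|\le c\,e^{-\gamma t}\|x(0)-\bar x\|$ for all $t\ge0$. *)

(* Defs.v *)
From HB Require Import structures.
From mathcomp Require Export all_boot all_order all_algebra.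
From mathcomp Require Export all_classical all_reals all_analysis.

Set Implicit Arguments.
Unset Strict Implicit.
Unset Printing Implicit Defensive.

Import Order.TTheory GRing.Theory Num.Theory.
Import numFieldNormedType.Exports.

#[global] Open Scope classical_set_scope.
#[global] Open Scope ring_scope.

Section Matrices.
Context {R : realType}.

Definition posdefmx n (A : 'M[R]_n) : Prop :=
  A^T = A /\ forall x : 'cV[R]_n, x != 0 -> 0 < (x^T *m A *m x) 0 0.

Definition negdefmx n (A : 'M[R]_n) : Prop :=
  A^T = A /\ forall x : 'cV[R]_n, x != 0 -> (x^T *m A *m x) 0 0 < 0.

Definition diag_of n (x : 'cV[R]_n) : 'M[R]_n := diag_mx x^T.

Definition tanh (x : R) : R :=
  (expR x - expR (- x)) / (expR x + expR (- x)).

Definition adjacency n (e : rel 'I_n) : 'M[R]_n := \matrix_(i, j) (e i j)%:R.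

Definition laplacian n (e : rel 'I_n) : 'M[R]_n :=
  diag_of (\col_i \sum_j adjacency e i j) - adjacency e.

(* Indices are 0-based: for i > 0, row i has -1 in column i - 1 and 1 in
   column i. *)
Definition Tmx n : 'M[R]_n :=
  \matrix_(i, j) if i == 0%N :> nat then n%:R^-1
                 else if j.+1 == i :> nat then -1
                 else (j == i)%:R.

(* [0 | I] of size (n - 1) x n; written entrywise because n.-1.+1 and n are
   not convertible for a variable n. *)
Definition Irmx n : 'M[R]_(n.-1, n) := \matrix_(i, j) (j == i.+1 :> nat)%:R.

End Matrices.

Section Stability.
Context {R : realType} {E : normedModType R}.

(* Forward solutions of x' = f x on [0, tmax[; the derivative is required on
   the open interval only, continuity at 0 fixes the initial value. *)
Definition solution_on (f : E -> E) (tmax : R) (x : R -> E) : Prop :=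
  {within `[0, tmax[, continuous x} /\
  forall t : R, 0 < t < tmax -> is_derive t 1 x (f (x t)).

Definition equilibrium (f : E -> E) (xbar : E) : Prop := f xbar = 0.

(* The bound is required of every solution on every [0, tmax[, hence also of
   those that are not a priori defined for all t >= 0.  In finite dimension
   the notion does not depend on the norm of E. *)
Definition exponentially_stable (f : E -> E) (xbar : E) : Prop :=
  equilibrium f xbar /\
  exists c gamma r : R, [/\ 0 < c, 0 < gamma, 0 < r &
    forall (tmax : R) (x : R -> E), 0 < tmax -> solution_on f tmax x ->
      `|x 0 - xbar| < r ->
      forall t, 0 <= t < tmax ->
        `|x t - xbar| <= c * expR (- (gamma * t)) * `|x 0 - xbar|].

End Stability.

(* All the data of the closed loop except tau_d, which stays a separate
   argument because it varies while everything else is fixed. *)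
Record microgrid (R : realType) (n : nat) := Microgrid {
  nbr : rel 'I_n;
  tau_v : R;
  beta : R;
  kgain : R;
  omega_nom : R;
  m_omega : 'cV[R]_n;
  S_rated : 'cV[R]_n;
  V_min : 'cV[R]_n;
  V_max : 'cV[R]_n;
  JPtheta : 'M[R]_n;
  JPV : 'M[R]_n;
  JQtheta : 'M[R]_n;
  JQV : 'M[R]_n;
  w_P : 'cV[R]_n;
  w_Q : 'cV[R]_n }.

Section System.
Context {R : realType} {n : nat}.
Variable G : microgrid R n.

Let L : 'M[R]_n := laplacian (nbr G).
Let m : 'M[R]_n := diag_of (m_omega G).
Let Sinv : 'M[R]_n := invmx (diag_of (S_rated G)).
Let T : 'M[R]_n := Tmx n.
Let Tinv : 'M[R]_n := invmx T.
Let Ir : 'M[R]_(n.-1, n) := Irmx n.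
Let one : 'cV[R]_n := const_mx 1.

Definition Vstar : 'cV[R]_n := 2^-1 *: (V_max G + V_min G).
Definition Delta : 'cV[R]_n := 2^-1 *: (V_max G - V_min G).
Definition Kmx : 'M[R]_n := invmx (1%:M + kgain G *: L).

Let dVstar : 'M[R]_n := diag_of Vstar.

Definition leak (v : 'cV[R]_n) (i : 'I_n) : R :=
  if 3 * Delta i 0 < `|v i 0| then `|v i 0 / Delta i 0| - 3 else 0.
Definition rho (v : 'cV[R]_n) : 'M[R]_n := diag_of (\col_i leak v i).

Definition Vof (v : 'cV[R]_n) : 'cV[R]_n :=
  Vstar + diag_of Delta *m map_mx tanh (invmx (diag_of Delta) *m v).

Definition Rtheta : 'M[R]_n.-1 :=
  - (Ir *m T *m m *m Sinv *m JPtheta G *m Tinv *m Ir^T).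
Definition RthetaV : 'M[R]_(n.-1, n) :=
  - (Ir *m T *m m *m Sinv *m JPV G).
Definition Rvtheta : 'M[R]_(n, n.-1) :=
  dVstar *m (Kmx - 1%:M) *m Sinv *m JQtheta G *m Tinv *m Ir^T.
Definition RvV : 'M[R]_n :=
  dVstar *m (Kmx - 1%:M) *m Sinv *m JQV G.
Definition Rvzeta : 'M[R]_(n, n.-1) :=
  - (dVstar *m Kmx *m L *m Tinv *m Ir^T).
Definition Rzetatheta : 'M[R]_n.-1 :=
  (tau_v G)^-1 *: (Ir *m T *m L *m Kmx *m Sinv *m JQtheta G *m Tinv *m Ir^T).
Definition RzetaV : 'M[R]_(n.-1, n) :=
  (tau_v G)^-1 *: (Ir *m T *m L *m Kmx *m Sinv *m JQV G).
Definition Rzeta : 'M[R]_n.-1 :=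
  - ((tau_v G)^-1 *: (Ir *m T *m L *m Kmx *m L *m Tinv *m Ir^T)).
Definition dtheta : 'cV[R]_n.-1 :=
  omega_nom G *: (Ir *m T *m one) - Ir *m T *m m *m Sinv *m w_P G.
Definition dv : 'cV[R]_n :=
  beta G *: Vstar + dVstar *m (Kmx - 1%:M) *m Sinv *m w_Q G.
Definition dzeta : 'cV[R]_n.-1 :=
  (tau_v G)^-1 *: (Ir *m T *m L *m Kmx *m Sinv *m w_Q G).

Definition Rvtheta_new : 'M[R]_(n, n.-1) :=
  Rvtheta - Rvzeta *m invmx Rzeta *m Rzetatheta.
Definition RvV_new : 'M[R]_n :=
  RvV - Rvzeta *m invmx Rzeta *m RzetaV.

Definition Qmx (Ptheta : 'M[R]_n.-1) (Dv : 'M[R]_n) : 'M[R]_(n.-1 + n) :=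
  block_mx (Ptheta *m Rtheta) (Ptheta *m RthetaV)
           (Dv *m Rvtheta_new) (Dv *m (RvV_new - (beta G)%:M)).

(* States are triples ((r_theta, v), r_zeta); the coefficients tau_v and
   eps = tau_d / tau_v of the derivatives are moved to the right-hand side. *)
Definition closed_loop (tau_d : R) (x : 'cV[R]_n.-1 * 'cV[R]_n * 'cV[R]_n.-1) :
    'cV[R]_n.-1 * 'cV[R]_n * 'cV[R]_n.-1 :=
  let: (rtheta, v, rzeta) := x in
  let V := Vof v in
  let eps := tau_d / tau_v G in
  (Rtheta *m rtheta + RthetaV *m V + dtheta,
   (tau_v G)^-1 *: (Rvtheta *m rtheta + (RvV - (beta G)%:M) *m V
                    + Rvzeta *m rzeta - rho v *m v + dv),
   eps^-1 *: (Rzetatheta *m rtheta + RzetaV *m V + Rzeta *m rzeta + dzeta)).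

End System.

(* Main.v *)
Require Import Defs.
From HB Require Import structures.
From mathcomp Require Import all_boot all_order all_algebra.
From mathcomp Require Import all_classical all_reals all_analysis.
From mathcomp Require Import ring lra.

(** Write [H(r, V)] for the quasi-steady state of [r_zeta].  Eliminating it
  leaves the reduced system in [s = (r, V)], whose linear part [M] satisfies
  [s^T N M s < 0] for [N = diag(P_theta, D_v)].

  Equilibrium.  With [J] the identity on [r] and the resolvent of the monotone
  leakage on [V], an equilibrium is a fixed point of
  [s |-> J (s + l (M s + b))], which for small [l] contracts the [N]-norm since
  [J] is nonexpansive there ([D_v] is diagonal).  Uniqueness follows from
  monotonicity.

  Stability.  Let [lam > 0] be the slopes of the saturations at the
  equilibrium.  In deviations [(r, v, z)] with [y = z - H(r, lam v)], the
  Lyapunov function is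
  [r^T P_theta r + tau_v v^T (D_v lam) v + y^T S^T S y], where [S] is [T^-1 I_r^T].
  The slow part decreases by the matrix inequality, the leakage only helps
  because [D_v lam] is diagonal, and [S^T S R_zeta] equals
  [- tau_v^-1 S^T L K L S], which is negative definite by connectedness; the
  decrease of order [1/eps] in [y] dominates all cross terms for small [eps].
  *)

Set Implicit Arguments.
Unset Strict Implicit.
Unset Printing Implicit Defensive.

Import Order.TTheory GRing.Theory Num.Theory.
Import numFieldNormedType.Exports.

Local Open Scope classical_set_scope.
Local Open Scope ring_scope.

(** * Sup norm, bilinear forms and compact balls of column vectors *)

Section MatrixNorm.
Context {R : realType}.

Lemma entry_le_norm m n (A : 'M[R]_(m, n)) i j : `|A i j| <= `|A|.
Proof. by rewrite [leRHS]/Num.Def.normr/= mx_normrE; exact: (le_bigmax _ _ (i, j)). Qed.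

Lemma norm_mx_le m n (A : 'M[R]_(m, n)) c :
  0 <= c -> (forall i j, `|A i j| <= c) -> `|A| <= c.
Proof.
by move=> c0 Ac; rewrite [leLHS]/Num.Def.normr/= mx_normrE bigmax_le// => ij _.
Qed.

Lemma norm_mulmx_le m n p (A : 'M[R]_(m, n)) (B : 'M[R]_(n, p)) :
  `|A *m B| <= n%:R * `|A| * `|B|.
Proof.
apply: norm_mx_le => [|i j]; first by rewrite !mulr_ge0.
rewrite mxE (le_trans (ler_norm_sum _ _ _))// -mulrA.
rewrite -[X in X%:R * _](card_ord n) mulr_natl -sumr_const ler_sum// => k _.
by rewrite normrM ler_pM// entry_le_norm.
Qed.

Lemma norm_trmx m n (A : 'M[R]_(m, n)) : `|A^T| = `|A|.
Proof.
have le_tr p q (B : 'M[R]_(p, q)) : `|B^T| <= `|B|.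
  by apply: norm_mx_le => // i j; rewrite mxE entry_le_norm.
by apply/le_anti; rewrite le_tr -{1}(trmxK A) le_tr.
Qed.

Definition bil m n (A : 'M[R]_(m, n)) (x : 'cV[R]_m) (y : 'cV[R]_n) : R :=
  (x^T *m A *m y) 0 0.

Lemma bilDl m n (A : 'M[R]_(m, n)) x x' y :
  bil A (x + x') y = bil A x y + bil A x' y.
Proof. by rewrite /bil linearD !mulmxDl mxE. Qed.

Lemma bilDr m n (A : 'M[R]_(m, n)) x y y' :
  bil A x (y + y') = bil A x y + bil A x y'.
Proof. by rewrite /bil mulmxDr mxE. Qed.

Lemma bilNl m n (A : 'M[R]_(m, n)) x y : bil A (- x) y = - bil A x y.
Proof. by rewrite /bil linearN !mulNmx mxE. Qed.

Lemma bilZl m n (A : 'M[R]_(m, n)) a x y : bil A (a *: x) y = a * bil A x y.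
Proof. by rewrite /bil linearZ /= -!scalemxAl mxE. Qed.

Lemma bilZr m n (A : 'M[R]_(m, n)) a x y : bil A x (a *: y) = a * bil A x y.
Proof. by rewrite /bil -!scalemxAr mxE. Qed.

Lemma bilM m n p (A : 'M[R]_(m, n)) (B : 'M[R]_(n, p)) x y :
  bil A x (B *m y) = bil (A *m B) x y.
Proof. by rewrite /bil !mulmxA. Qed.

Lemma bilMl m n p (A : 'M[R]_(m, n)) (B : 'M[R]_(m, p)) x y :
  bil A (B *m x) y = bil (B^T *m A) x y.
Proof. by rewrite /bil trmx_mul !mulmxA. Qed.

Lemma bil_tr m n (A : 'M[R]_(m, n)) x y : bil A^T x y = bil A y x.
Proof.
have -> : bil A y x = (y^T *m A *m x)^T 0 0 by rewrite mxE.
by rewrite /bil !trmx_mul trmxK mulmxA.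
Qed.

Lemma bilC m (A : 'M[R]_m) x y : A^T = A -> bil A x y = bil A y x.
Proof. by move=> {1}<-; rewrite bil_tr. Qed.

Lemma bilA m n (A B : 'M[R]_(m, n)) x y : bil (A + B) x y = bil A x y + bil B x y.
Proof. by rewrite /bil mulmxDr mulmxDl mxE. Qed.

Lemma bilN m n (A : 'M[R]_(m, n)) x y : bil (- A) x y = - bil A x y.
Proof. by rewrite /bil mulmxN mulNmx mxE. Qed.

Lemma bilE m n (A : 'M[R]_(m, n)) x y :
  bil A x y = \sum_i \sum_j x i 0 * A i j * y j 0.
Proof.
rewrite /bil mxE exchange_big/=; apply: eq_bigr => j _.
by rewrite mxE mulr_suml; apply: eq_bigr => i _; rewrite !mxE.
Qed.

Lemma bil_diag n (d : 'rV[R]_n) x y :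
  bil (diag_mx d) x y = \sum_i d 0 i * (x i 0 * y i 0).
Proof.
rewrite /bil mul_mx_diag mxE; apply: eq_bigr => i _; rewrite !mxE; ring.
Qed.

Lemma bil_diag_gt0 n (d : 'rV[R]_n) x :
  (forall i, 0 < d 0 i) -> x != 0 -> 0 < bil (diag_mx d) x x.
Proof.
move=> d0 x0; have ge0 i : 0 <= d 0 i * (x i 0 * x i 0).
  by rewrite mulr_ge0 ?(ltW (d0 i))// -expr2 sqr_ge0.
rewrite bil_diag lt_neqAle sumr_ge0// andbT eq_sym.
apply: contra x0 => /eqP /psumr_eq0P s0; apply/eqP/colP => i; rewrite mxE.
have /eqP := s0 (fun i _ => ge0 i) i isT.
by rewrite mulf_eq0 gt_eqF//= mulf_eq0 orbb => /eqP.
Qed.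

Lemma bilZ m n (A : 'M[R]_(m, n)) a x y : bil (a *: A) x y = a * bil A x y.
Proof. by rewrite /bil -scalemxAr -scalemxAl mxE. Qed.

Lemma bil_block m n p q (A : 'M[R]_(m, p)) (B : 'M[R]_(m, q)) (C : 'M[R]_(n, p))
    (D : 'M[R]_(n, q)) x y z t :
  bil (block_mx A B C D) (col_mx x y) (col_mx z t) =
  bil A x z + bil B x t + bil C y z + bil D y t.
Proof.
rewrite /bil tr_col_mx mul_row_block mul_row_col !mulmxDl !mxE; ring.
Qed.

Lemma bil_le m n (A : 'M[R]_(m, n)) :
  exists2 K, 0 < K & forall x y, `|bil A x y| <= K * (`|x| * `|y|).
Proof.
(* The added [1] keeps the constant positive even when [A = 0] or a dimension vanishes. *)
exists ((n * m)%:R * `|A| + 1) => [|x y]; first by rewrite ltr_wpDl// mulr_ge0.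
apply: le_trans (entry_le_norm _ _ _) _.
apply: le_trans (norm_mulmx_le _ _) _.
have := ler_wpM2l (ler0n R n) (norm_mulmx_le x^T A).
rewrite norm_trmx => /(ler_wpM2r (normr_ge0 y)) h.
apply: le_trans h _; rewrite natrM.
have : 0 <= `|x| * `|y| by rewrite mulr_ge0.
set a := `|x|; set b := `|y|; nra.
Qed.

Lemma mulmx_le m n (A : 'M[R]_(m, n)) :
  exists2 K, 0 < K & forall x : 'cV_n, `|A *m x| <= K * `|x|.
Proof.
exists (n%:R * `|A| + 1) => [|x]; first by rewrite ltr_wpDl// mulr_ge0.
by rewrite (le_trans (norm_mulmx_le _ _))// ler_wpM2r// lerDl.
Qed.

Lemma lipschitz_continuous_map (E F : normedModType R) (f : E -> F) K :
  0 < K -> (forall x y, `|f x - f y| <= K * `|x - y|) -> continuous f.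
Proof.
move=> K0 fK x; apply/cvgrPdist_le => e e0; near=> y.
rewrite (le_trans (fK _ _))// -ler_pdivlMl// mulrC; near: y.
by apply: cvgr_dist_le; rewrite // divr_gt0.
Unshelve. all: by end_near. Qed.

Lemma linear_map_continuous (E F : normedModType R) (f : E -> F) K :
  linear f -> 0 < K -> (forall x, `|f x| <= K * `|x|) -> continuous f.
Proof.
move=> fl K0 fK; apply: lipschitz_continuous_map K0 _ => x y.
have -> : f x - f y = f (x - y).
  by rewrite [in RHS]addrC -[in RHS]scaleN1r fl scaleN1r addrC.
exact: fK.
Qed.

(** A sup-norm ball is a product of segments. [rV_compact] handles such boxes of row vectors, and
    transposition, being an isometry, carries compactness over to columns. *)
Lemma cV_ball_compact n (c : R) : 0 <= c -> compact [set x : 'cV[R]_n | `|x| <= c].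
Proof.
move=> c0; have -> : [set x : 'cV[R]_n | `|x| <= c] =
    trmx @` [set x : 'rV[R]_n | forall i, `[- c, c]%classic (x ord0 i)].
  apply/seteqP; split=> [x /= xc|_ /= [x xc <-]].
    exists x^T; last by rewrite trmxK.
    move=> i; rewrite mxE in_itv/= -ler_norml; exact: le_trans (entry_le_norm _ _ _) xc.
  rewrite norm_trmx; apply: norm_mx_le => // i j; rewrite ord1.
  by have := xc j; rewrite /= in_itv/= -ler_norml.
apply: continuous_compact.
  apply: continuous_subspaceT; apply: (@lipschitz_continuous_map _ _ _ 1) => // x y.
  by rewrite -linearB norm_trmx mul1r.
apply: (@rV_compact _ _ (fun=> `[- c, c]%classic)) => _; exact: segment_compact.
Qed.

End MatrixNorm.

(** * Definite quadratic forms and fixed points of contractions *)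

Section Forms.
Context {R : realType}.

Lemma bil_continuous n (A : 'M[R]_n) : continuous (fun x => bil A x x).
Proof.
have -> : (fun x => bil A x x) =
    \sum_i \sum_j (fun x : 'cV[R]_n => x i 0 * A i j * x j 0).
  apply/funext => x; rewrite bilE fct_sumE; apply: eq_bigr => i _.
  by rewrite fct_sumE.
move=> x; apply: differentiable_continuous.
apply: differentiable_sum => i; apply: differentiable_sum => j.
apply: differentiableM; last exact: differentiable_coord.
by apply: differentiableM => //; exact: differentiable_coord.
Qed.

(** The constant is the minimum of the form on the compact unit sphere of the sup norm; homogeneity
    extends the bound to every vector. *)
Lemma bil_ge n (A : 'M[R]_n) : (forall x, x != 0 -> 0 < bil A x x) ->
  exists2 c, 0 < c & forall x, c * `|x| ^+ 2 <= bil A x x.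
Proof.
move=> A0; pose S := [set x : 'cV[R]_n | `|x| = 1].
have [[x0 x0S]|S0] := pselect (S !=set0); last first.
  (* An empty unit sphere means that every vector is zero, so any positive constant does. *)
  exists 1 => // x; rewrite mul1r.
  have [->|xn0] := eqVneq x 0; first by rewrite normr0 expr0n/= /bil mulmx0 mxE.
  exfalso; apply: S0; exists (`|x|^-1 *: x).
  by rewrite /S/= normrZ normfV normr_id mulVf// normr_eq0.
have cS : compact S.
  apply: (@subclosed_compact _ S _ _ (@cV_ball_compact R n 1 ler01)).
    pose N (x : 'cV[R]_n) := `|x|.
    have : closed (N @^-1` [set y : R | y = 1]).
      have cn : {in ~` (N @^-1` [set y : R | y = 1]), continuous N}.
        by move=> x _; exact: norm_continuous.
      exact: (preimage_closed cn (@closed_eq R 1)).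
    by [].
  by move=> x /= ->.
have /= [] := compact_EVT_min (ex_intro _ _ x0S) cS
  (continuous_subspaceT (@bil_continuous n A)).
move=> y /set_mem yS ymin; exists (bil A y y).
  by apply: A0; rewrite -normr_gt0 yS.
move=> x; have [->|xn0] := eqVneq x 0.
  by rewrite normr0 expr0n/= mulr0 /bil mulmx0 mxE.
have nx0 : 0 < `|x| by rewrite normr_gt0.
have := ymin (`|x|^-1 *: x); rewrite inE /S/= normrZ normfV normr_id mulVf ?gt_eqF//.
move=> /(_ erefl); rewrite bilZl bilZr mulrA -expr2 exprVn mulrC.
by rewrite ler_pdivlMr// exprn_gt0.
Qed.

Lemma bil_le_neg m (A : 'M[R]_m) : (forall x, x != 0 -> bil A x x < 0) ->
  exists2 c, 0 < c & forall x, bil A x x <= - c * `|x| ^+ 2.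
Proof.
move=> A0; have [x x0|c c0 h] := @bil_ge _ (- A).
  by rewrite bilN oppr_gt0 A0.
by exists c => // x; have := h x; rewrite bilN; lra.
Qed.

(** Instead of iterating, the displacement [|F x - x|] is minimized over the ball of radius
    [4 * |F 0|]. Outside it the displacement exceeds its value at [0], so the minimum is global;
    applying [F] to the minimizer would halve it, hence it is zero. *)
Lemma contraction_fixed_point n (F : 'cV[R]_n -> 'cV[R]_n) :
  (forall x y, `|F x - F y| <= 2^-1 * `|x - y|) -> exists x, F x = x.
Proof.
move=> Flip.
have hc : continuous (fun x => `|F x - x|).
  apply: (@lipschitz_continuous_map _ _ _ _ 2) => // x y.
  apply: le_trans (ler_dist_dist _ _) _.
  have -> : F x - x - (F y - y) = (F x - F y) - (x - y).
    by rewrite !opprB [y - F y]addrC addrACA [- x + y]addrC.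
  apply: le_trans (ler_normB _ _) _.
  by have := Flip x y; have := normr_ge0 (x - y); lra.
pose c := 4 * `|F 0|.
have c0 : 0 <= c by rewrite mulr_ge0.
have B0 : [set x : 'cV[R]_n | `|x| <= c] !=set0 by exists 0; rewrite /= normr0.
have [x /set_mem/= xc xmin] := compact_EVT_min B0 (@cV_ball_compact R n c c0)
  (continuous_subspaceT hc).
exists x; apply/eqP; rewrite -subr_eq0 -normr_le0.
have hmin y : `|F x - x| <= `|F y - y|.
  have [yc|yc] := leP `|y| c; first by apply: xmin; rewrite inE.
  have := xmin 0; rewrite inE/= normr0 subr0 => /(_ c0).
  have := Flip y 0; rewrite subr0.
  have : `|y| <= `|F y - y| + `|F y - F 0| + `|F 0|.
    have {1}-> : y = - (F y - y) + (F y - F 0) + F 0.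
      by rewrite opprB -addrA subrK addrC addrCA subrr addr0.
    by rewrite -(normrN (F y - y)) (le_trans (ler_normD _ _))// lerD2r ler_normD.
  by move: yc; rewrite /c; lra.
by have := hmin (F x); have := Flip (F x) x; lra.
Qed.

(* A contraction in the norm of a form need not contract the sup norm carried
   by ['cV], but a high enough iterate does. *)
Lemma form_contraction_fixed_point n (N : 'M[R]_n) (f : 'cV[R]_n -> 'cV[R]_n) k :
  (forall x, x != 0 -> 0 < bil N x x) -> 0 <= k < 1 ->
  (forall x y, bil N (f x - f y) (f x - f y) <= k * bil N (x - y) (x - y)) ->
  exists x, f x = x.
Proof.
move=> N0 /andP[k0 k1] fk.
have [c c0 cN] := bil_ge N0; have [C C0 NC] := bil_le N.
have fki i x y : bil N (iter i f x - iter i f y) (iter i f x - iter i f y) <=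
    k ^+ i * bil N (x - y) (x - y).
  elim: i => [|i IH]; first by rewrite mul1r.
  by rewrite (le_trans (fk _ _))// exprS -mulrA ler_wpM2l.
have [i ki] : exists i, k ^+ i <= c / (4 * C).
  have : k ^+ i @[i --> \oo] --> 0 by apply: cvg_expr; rewrite ger0_norm.
  move=> /cvgrPdist_le/(_ (c / (4 * C)))[|i _ /(_ i (leqnn i))/=].
    by rewrite divr_gt0// mulr_gt0.
  by rewrite sub0r normrN ger0_norm ?exprn_ge0// => ?; exists i.
have lip x y : `|iter i f x - iter i f y| <= 2^-1 * `|x - y|.
  rewrite -(@ler_pXn2r _ 2)// ?nnegrE ?mulr_ge0 ?invr_ge0//.
  rewrite -(ler_pM2l c0) (le_trans (cN _))// (le_trans (fki i x y))//.
  have := le_trans (ler_norm _) (NC (x - y) (x - y)) => h.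
  apply: le_trans (ler_wpM2l (exprn_ge0 i k0) h) _.
  have -> : k ^+ i * (C * (`|x - y| * `|x - y|)) = k ^+ i * C * `|x - y| ^+ 2.
    by ring.
  have -> : c * (2^-1 * `|x - y|) ^+ 2 = c / 4 * `|x - y| ^+ 2 by field.
  rewrite ler_wpM2r ?exprn_ge0//.
  have -> : c / 4 = c / (4 * C) * C by field; rewrite gt_eqF.
  by rewrite ler_wpM2r// ltW.
have [x xF] := contraction_fixed_point lip.
exists x; apply/eqP; rewrite -subr_eq0 -normr_le0.
(* [f x] is again a fixed point of the iterate, and a contraction has only one. *)
have := lip (f x) x; rewrite -iterSr iterS xF.
by have := normr_ge0 (f x - x); lra.
Qed.

End Forms.

(** * Derivatives along curves *)

Section Curves.
Context {R : realType}.

(** The bound [K] makes [f] continuous; a continuous linear map is its own differential, and the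
    chain rule applies. *)
Lemma is_derive_linear (E F : normedModType R) (f : E -> F) K (x : R -> E) (t : R) d :
  linear f -> 0 < K -> (forall x, `|f x| <= K * `|x|) ->
  is_derive t 1 x d -> is_derive t 1 (fun s => f (x s)) (f d).
Proof.
move=> fl K0 fK [dx <-].
pose g : {linear E -> F} := HB.pack f (GRing.isLinear.Build _ _ _ _ f fl).
have gc : continuous g := linear_map_continuous fl K0 fK.
have dg y : differentiable g y by exact: linear_differentiable.
have dx' := derivable1_diffP x t.
split; first by apply/derivable1_diffP/differentiable_comp => //; exact/dx'.
rewrite -!derive1E derive1E'; last by apply: differentiable_comp => //; exact/dx'.
rewrite (_ : (fun s => f (x s)) = g \o x)// diff_comp//; last exact/dx'.
rewrite [LHS]/=.
have -> : ('d g (x t) : E -> F) = g by exact: diff_lin.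
by rewrite derive1E' //; exact/dx'.
Qed.

Lemma is_derive_form n (P : 'M[R]_n) (a : R -> 'cV[R]_n) (t : R) d :
  P^T = P -> is_derive t 1 a d ->
  is_derive t 1 (fun s => bil P (a s) (a s)) (2 * bil P d (a t)).
Proof.
move=> Psym da.
have de i : is_derive t 1 (fun s => a s i 0) (d i 0).
  apply: (@is_derive_linear _ _ (fun x : 'cV[R]_n => x i 0 : R) 1) da => //.
    by move=> c x y; rewrite !mxE.
  by move=> x; rewrite mul1r; exact: entry_le_norm.
have -> : (fun s => bil P (a s) (a s)) =
    \sum_i \sum_j (fun s => a s i 0 * P i j * a s j 0).
  apply/funext => s; rewrite bilE fct_sumE; apply: eq_bigr => i _.
  by rewrite fct_sumE.
apply: is_derive_eq.
have -> : 2 * bil P d (a t) = bil P (a t) d + bil P d (a t).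
  by rewrite -[in bil P (a t) d]Psym bil_tr; ring.
rewrite !bilE -big_split/=; apply: eq_bigr => i _.
rewrite -big_split/=; apply: eq_bigr => j _.
by rewrite /GRing.scale/= mulr0 add0r; ring.
Qed.

End Curves.

(** * A Lyapunov criterion for exponential stability *)

Section Lyapunov.
Context {R : realType} {E : normedModType R}.

(** The exit time is the infimum of the times at which [N] has reached [b]; by continuity the
    infimum is itself such a time. *)
Lemma first_exit (N : R -> R) (T b : R) :
  0 <= T -> {within `[0, T], continuous N} -> b <= N T -> N 0 < b ->
  exists t0, [/\ 0 < t0 <= T, b <= N t0 & forall s, 0 <= s < t0 -> N s < b].
Proof.
move=> T0 Nc bT N0; pose A := [set s | 0 <= s <= T /\ b <= N s].
have A_lb : has_lbound A by exists 0 => s /= [/andP[]].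
have AT : A T by rewrite /A/= T0 lexx.
have A0 : A !=set0 by exists T.
have t0T : inf A <= T by exact: ge_inf.
have t0ge0 : 0 <= inf A by apply: lb_le_inf => // s /= [/andP[]].
have bt0 : b <= N (inf A).
  rewrite leNgt; apply/negP => Nb.
  have /(_ (inf A)) := (subspace_continuousP _ _).1 Nc.
  rewrite /= in_itv/= t0ge0 t0T => /(_ isT) /(cvgr_lt _)/(_ _ Nb).
  move=> /nbhs_ballP[d /= d0 dN].
  have [s As sd] := inf_adherent d0 (conj A0 A_lb).
  have [/= sT bs] := As.
  have := dN s; rewrite /= /ball/= distrC ger0_norm ?subr_ge0 ?ge_inf//.
  rewrite ltrBlDl => /(_ sd).
  by rewrite in_itv/= => /(_ sT); rewrite ltNge bs.
exists (inf A); split => //.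
  by rewrite t0T andbT lt_neqAle t0ge0 andbT; apply: contraTneq bt0 => <-; rewrite -ltNge.
move=> s /andP[s0 st0]; rewrite ltNge; apply/negP => bs.
move: (st0); rewrite ltNge => /negP; apply; apply: ge_inf => //.
by split=> //; rewrite s0 (le_trans (ltW st0)).
Qed.

(** With [g = mu / C], the quantity [expR (g * t) * W (x t)] does not increase while the solution
    stays within [r0]. A start within [r0 * sqrt (c / C)] gives [W] a value below [c * r0 ^+ 2],
    which a first exit from the ball would have to reach, so the solution never leaves. *)
Lemma lyapunov_exponentially_stable (f : E -> E) (xbar : E) (W dW : E -> R)
    (c C mu r0 : R) :
  0 < c -> 0 < C -> 0 < mu -> 0 < r0 ->
  equilibrium f xbar -> continuous W ->
  (forall x, c * `|x - xbar| ^+ 2 <= W x <= C * `|x - xbar| ^+ 2) ->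
  (forall (x : R -> E) (t : R), is_derive t 1 x (f (x t)) ->
     is_derive t 1 (fun s => W (x s)) (dW (x t))) ->
  (forall x, `|x - xbar| < r0 -> dW x <= - mu * `|x - xbar| ^+ 2) ->
  exponentially_stable f xbar.
Proof.
move=> c0 C0 mu0 r00 feq Wc Wb dWx dWle; split => //.
pose g := mu / C; have g0 : 0 < g by rewrite divr_gt0.
(* [W] is comparable to the square of the distance, hence the square roots and the halved rate. *)
exists (Num.sqrt (C / c)), (g / 2), (r0 * Num.sqrt (c / C)).
split; rewrite ?(mulr_gt0, divr_gt0, sqrtr_gt0, invr_gt0)//.
move=> tmax x tmax0 [xc dx] x0r.
pose u t := expR (g * t) * W (x t).
have xcT T : T < tmax -> {within `[0, T], continuous x}.
  move=> Tmax; apply: continuous_subspaceW xc => s /=.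
  by rewrite !in_itv/= => /andP[-> /le_lt_trans]; exact.
have du t : 0 < t < tmax ->
    is_derive t 1 u (expR (g * t) * dW (x t) + g * expR (g * t) * W (x t)).
  move=> /dx /dWx dWt; rewrite /u.
  apply: is_derive_eq; rewrite /GRing.scale/=; ring.
(* Only times strictly before [T] have to be in the ball, so the claim applies at the first exit
   time itself. *)
have u_le T : 0 <= T < tmax -> (forall s, 0 < s < T -> `|x s - xbar| < r0) ->
    u T <= u 0.
  move=> /andP[T0 Tmax] xr.
  have sub s : s \in `]0, T[ -> 0 < s < tmax.
    by rewrite in_itv/= => /andP[-> /lt_trans]; exact.
  apply: (@ler0_derive1_le_cc _ u 0 T) => //; rewrite ?in_itv/= ?lexx ?T0//.
  - by move=> s /sub/du [].
  - move=> s sT; have [_] := du s (sub s sT); rewrite derive1E => ->.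
    have /dWle dWs : `|x s - xbar| < r0 by apply: xr; rewrite in_itv/= in sT.
    have /andP[_ Ws] := Wb (x s).
    have gW : g * W (x s) <= mu * `|x s - xbar| ^+ 2.
      by rewrite /g -mulrA ler_pM2l// ler_pdivrMl.
    have -> : expR (g * s) * dW (x s) + g * expR (g * s) * W (x s) =
        expR (g * s) * (dW (x s) + g * W (x s)) by ring.
    by rewrite mulr_ge0_le0 ?expR_ge0//; lra.
  - move=> s.
    apply: (@continuousM _ (subspace `[0, T]%classic) (fun t => expR (g * t))
      (fun t => W (x t)) s).
      apply: continuous_subspaceT => {}s.
      apply: continuous_comp; last exact: continuous_expR.
      exact: mulrl_continuous.
    have := xcT _ Tmax s.
    by move=> /continuous_comp; apply; exact: Wc.
have u0 : u 0 <= C * `|x 0 - xbar| ^+ 2.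
  by rewrite /u mulr0 expR0 mul1r; have /andP[] := Wb (x 0).
have x0b : C * `|x 0 - xbar| ^+ 2 < c * r0 ^+ 2.
  have : `|x 0 - xbar| ^+ 2 < (r0 * Num.sqrt (c / C)) ^+ 2.
    by rewrite ltr_pXn2r// ?nnegrE ?mulr_ge0 ?sqrtr_ge0 ?(ltW r00)//.
  rewrite exprMn sqr_sqrtr ?divr_ge0 ?ltW// -(ltr_pM2l C0) => /lt_le_trans; apply.
  by rewrite le_eqVlt; apply/orP; left; apply/eqP; field; rewrite gt_eqF.
have x0r0 : `|x 0 - xbar| < r0.
  have : c * `|x 0 - xbar| ^+ 2 < c * r0 ^+ 2.
    by apply: le_lt_trans x0b; have /andP[+ h] := Wb (x 0) => /le_trans; apply.
  by rewrite ltr_pM2l// ltr_pXn2r// nnegrE// ltW.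
have W_le t : 0 <= t -> u t <= u 0 ->
    c * `|x t - xbar| ^+ 2 <= expR (- (g * t)) * (C * `|x 0 - xbar| ^+ 2).
  move=> t0 ut; have /andP[Wt _] := Wb (x t); apply: le_trans Wt _.
  rewrite expRN ler_pdivlMl ?expR_gt0//; exact: le_trans ut u0.
have xr t : 0 <= t < tmax -> `|x t - xbar| < r0.
  move=> /andP[t0 tm]; rewrite ltNge; apply/negP => xt.
  have Nc : {within `[0, t], continuous (fun s => `|x s - xbar|)}.
    move=> s; have := xcT _ tm s.
    move=> /(@continuous_comp _ _ _ _ (fun y => `|y - xbar|)); apply.
    apply: (@lipschitz_continuous_map _ _ _ _ 1) => // y z.
    apply: le_trans (ler_dist_dist _ _) _.
    by rewrite opprB addrA subrK mul1r.
  have [t1 [/andP[t10 t1t] xt1 xs]] := first_exit t0 Nc xt x0r0.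
  have := W_le t1 (ltW t10).
  have -> : u t1 <= u 0.
    apply: u_le => [|s /andP[s0 st1]]; last by apply: xs; rewrite ltW.
    by rewrite ltW//= (le_lt_trans t1t).
  move=> /(_ isT) h.
  have : c * r0 ^+ 2 <= c * `|x t1 - xbar| ^+ 2.
    by rewrite ler_pM2l// ler_pXn2r// nnegrE// ltW.
  move=> /le_trans/(_ h); apply/negP; rewrite -ltNge.
  apply: le_lt_trans x0b; rewrite ler_piMl ?mulr_ge0 ?(ltW C0)//.
  by rewrite expR_le1 oppr_le0 mulr_ge0// ltW.
move=> t /[dup] tT /andP[t0 tm].
have ut : u t <= u 0.
  by apply: u_le => // s /andP[s0 st]; apply: xr; rewrite ltW//= (lt_trans st).
have := W_le t t0 ut => Wt.
rewrite -(@ler_pXn2r _ 2)// ?nnegrE ?mulr_ge0 ?sqrtr_ge0 ?expR_ge0//.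
rewrite !exprMn sqr_sqrtr ?divr_ge0 ?(ltW c0) ?(ltW C0)// -expRM_natl.
have -> : 2%:R * - (g / 2 * t) = - (g * t) by field.
apply: (@le_trans _ _ (c^-1 * (expR (- (g * t)) * (C * `|x 0 - xbar| ^+ 2)))).
  by rewrite ler_pdivlMl.
by rewrite le_eqVlt; apply/orP; left; apply/eqP; ring.
Qed.

End Lyapunov.

(** * The scalar resolvent of the leakage *)

Section Resolvent.
Context {R : realType}.
Variables (sig phi : R -> R).
Hypothesis sig_cont : continuous sig.
Hypothesis phi_cont : continuous phi.
Hypothesis sig_homo : {homo sig : x y / x <= y}.
Hypothesis phi_homo : {homo phi : x y / x <= y}.
Hypothesis phi_up : forall c, exists2 v, 0 <= v & c <= phi v.
Hypothesis phi_down : forall c, exists2 v, v <= 0 & phi v <= c.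

(** Intermediate values: [phi_up] and [phi_down] give points on either side of [0] where [l * phi]
    alone makes up for [y - sig 0], and monotonicity of [sig] can only help there. *)
Lemma resolvent_exists (l : R) : 0 < l -> forall y, exists v, sig v + l * phi v = y.
Proof.
move=> l0 y.
have [b b0 hb] := phi_up ((y - sig 0) / l).
have [a a0 ha] := phi_down ((y - sig 0) / l).
have sb := sig_homo b0; have sa := sig_homo a0.
have hb' : y <= sig b + l * phi b.
  by rewrite ler_pdivrMr// in hb; lra.
have ha' : sig a + l * phi a <= y.
  by rewrite ler_pdivlMr// in ha; lra.
have ab : a <= b := le_trans a0 b0.
have hc : continuous (fun v => sig v + l * phi v).
  move=> v; apply: (@continuousD _ _ _ sig (fun w => l * phi w)).
    exact: sig_cont.
  by apply: (@continuousM _ _ (fun=> l)); [exact: cvg_cst|exact: phi_cont].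
have [|v _ <-] := @IVT R (fun v => sig v + l * phi v) a b y ab (continuous_subspaceT hc).
  by rewrite ge_min ha' le_max hb' orbT.
by exists v.
Qed.

(** The increments of [sig] and [phi] have the same sign, so adding the second to the first enlarges
    its absolute value. *)
Lemma resolvent_nonexpansive (l v w : R) : 0 < l ->
  (sig v - sig w) ^+ 2 <= (sig v + l * phi v - (sig w + l * phi w)) ^+ 2.
Proof.
move=> l0; wlog wv : v w / w <= v => [hw|].
  have [/hw//|/ltW/hw] := leP w v.
  by rewrite -[X in X <= _]sqrrN -[X in _ <= X]sqrrN !opprB.
have s := sig_homo wv; have p := phi_homo wv.
rewrite ler_pXn2r// ?nnegrE; nra.
Qed.

End Resolvent.

(** * Existence of an equilibrium of the reduced system *)

Section ReducedEquilibrium.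
Context {R : realType} (p n : nat).
Variables (sig phi : 'I_n -> R -> R).
Hypothesis sig_cont : forall i, continuous (sig i).
Hypothesis phi_cont : forall i, continuous (phi i).
Hypothesis sig_homo : forall i, {homo sig i : x y / x <= y}.
Hypothesis phi_homo : forall i, {homo phi i : x y / x <= y}.
Hypothesis phi_up : forall i c, exists2 v, 0 <= v & c <= phi i v.
Hypothesis phi_down : forall i c, exists2 v, v <= 0 & phi i v <= c.

Definition colmap (g : 'I_n -> R -> R) (v : 'cV[R]_n) : 'cV[R]_n :=
  \col_i g i (v i 0).

(** A forward-backward splitting: [u] is an explicit step along the affine part and [J] an implicit
    step for [phi], expressed in the variable [sig v]. *)
Lemma reduced_equilibrium (P : 'M[R]_p) (d : 'rV[R]_n) (M : 'M[R]_(p + n))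
    (b : 'cV[R]_(p + n)) :
  P^T = P -> (forall x, x != 0 -> 0 < bil P x x) -> (forall i, 0 < d 0 i) ->
  (forall x, x != 0 -> bil (block_mx P 0 0 (diag_mx d) *m M) x x < 0) ->
  exists r v, M *m col_mx r (colmap sig v) + b = col_mx 0 (colmap phi v).
Proof.
move=> Psym P0 d0 NM; set N := block_mx P 0 0 (diag_mx d) in NM *.
have NE x y z t : bil N (col_mx x y) (col_mx z t) =
    bil P x z + \sum_i d 0 i * (y i 0 * t i 0).
  by rewrite bil_block bil_diag /bil !mulmx0 !mul0mx !mxE !addr0.
have Nsym : N^T = N by rewrite tr_block_mx Psym tr_diag_mx !trmx0.
have N0 x : x != 0 -> 0 < bil N x x.
  rewrite -[x]vsubmxK NE; set r := usubmx x; set s := dsubmx x => x0.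
  rewrite -bil_diag; have [s0|/(bil_diag_gt0 d0) s_gt0] := eqVneq s 0.
    rewrite s0 [bil (diag_mx d) _ _]/bil mulmx0 mxE addr0 P0//.
    by apply: contra x0 => /eqP ->; rewrite s0 col_mx0.
  have [->|/P0 r_gt0] := eqVneq r 0; last exact: addr_gt0.
  by rewrite {1}/bil mulmx0 mxE add0r.
have [mu mu0 NMle] := bil_le_neg NM.
have [C C0 NC] := bil_le (M^T *m N *m M).
have [C' C'0 NC'] := bil_le N.
(* This step length minimizes [- 2 * l * mu + l ^+ 2 * C], the bound on the change of the squared
   [N]-norm under the forward step. *)
pose l := mu / C; have l0 : 0 < l by rewrite divr_gt0.
have res i y : exists v, sig i v + l * phi i v = y.
  exact: (@resolvent_exists _ _ _ (@sig_cont i) (@phi_cont i)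
    (@sig_homo i) (@phi_up i) (@phi_down i)).
pose J i y := sig i (sval (cid (res i y))).
pose u w := w + l *: (M *m w + b).
pose f w := col_mx (usubmx (u w)) (colmap J (dsubmx (u w))).
(* The voltage block of [N] is diagonal, so nonexpansiveness reduces to one scalar resolvent per
   coordinate. *)
have fu w w' : bil N (f w - f w') (f w - f w') <= bil N (u w - u w') (u w - u w').
  rewrite -[u w - u w']vsubmxK /f opp_col_mx add_col_mx !NE !linearB/=.
  rewrite lerD2l; apply: ler_sum => i _; rewrite ler_wpM2l ?(ltW (d0 i))//.
  rewrite !mxE -!expr2 /J.
  case: (cid _) => v /= <-; case: (cid _) => v' /= <-.
  exact: (resolvent_nonexpansive (@sig_homo i) (@phi_homo i)).
(* Enlarging [C'] in this way makes [C * C''] at least [mu ^+ 2], so that the factor [k] below is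
   nonnegative. *)
pose C'' := C' + mu ^+ 2 / C.
have mC0 : 0 < mu ^+ 2 / C by rewrite divr_gt0// exprn_gt0.
have C''0 : 0 < C'' by rewrite addr_gt0.
pose k := 1 - mu ^+ 2 / (C * C'').
have [x fx] : exists x, f x = x.
  apply: (@form_contraction_fixed_point _ _ N f k N0).
    rewrite /k subr_ge0 ltrBlDr ltrDl.
    have CC0 : 0 < C * C'' by rewrite mulr_gt0.
    rewrite ler_pdivrMr// mul1r divr_gt0 ?exprn_gt0// andbT.
    have -> : C * C'' = C * C' + mu ^+ 2 by rewrite /C''; field; rewrite gt_eqF.
    by rewrite lerDr mulr_ge0// ltW.
  move=> y z; apply: le_trans (fu _ _) _; set e := y - z.
  have -> : u y - u z = e + l *: (M *m e).
    by rewrite /u /e mulmxBr opprD addrACA -scalerBr opprD addrACA subrr addr0.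
  move: e => e; rewrite !(bilDl, bilDr, bilZl, bilZr).
  have -> : bil N (M *m e) e = bil N e (M *m e) by rewrite -{1}Nsym bil_tr.
  rewrite bilMl !bilM.
  have h1 := NMle e.
  have h2 := le_trans (ler_norm _) (NC e e).
  have h3 := le_trans (ler_norm _) (NC' e e).
  rewrite -!expr2 in h2 h3.
  set a := `|e| ^+ 2 in h1 h2 h3; have a0 : 0 <= a by rewrite exprn_ge0.
  have h4 : mu ^+ 2 / (C * C'') * bil N e e <= mu ^+ 2 / C * a.
    have -> : mu ^+ 2 / (C * C'') * bil N e e = mu ^+ 2 / C * (bil N e e / C'').
      by field; rewrite !gt_eqF.
    rewrite ler_pM2l// ler_pdivrMr// (le_trans h3)// mulrC ler_wpM2l//.
    by rewrite /C'' lerDl ltW.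
  have h5 : l * bil (N *m M) e e <= - (mu ^+ 2 / C) * a.
    have -> : - (mu ^+ 2 / C) * a = l * (- mu * a) by rewrite /l; ring.
    by rewrite ler_pM2l.
  have h6 : l * (l * bil (M^T *m N *m M) e e) <= mu ^+ 2 / C * a.
    have -> : mu ^+ 2 / C * a = l * (l * (C * a)).
      by rewrite /l; field; rewrite gt_eqF.
    by rewrite !ler_pM2l.
  rewrite /k mulrBl mul1r; lra.
(* The resolvent solutions behind [J]: [sig v] is the voltage part of the fixed point, and
   cancelling it leaves [l *: colmap phi v] against the forward increment. *)
pose v := \col_i sval (cid (res i (dsubmx (u x) i 0))).
exists (usubmx x), v.
have xE : col_mx (usubmx x) (colmap sig v) = x.
  rewrite -[RHS]vsubmxK -{3}fx col_mxKd; congr col_mx.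
  by apply/colP => i; rewrite !mxE.
rewrite xE -[LHS]vsubmxK; congr col_mx; apply: (scalerI (lt0r_neq0 l0)).
  have := congr1 usubmx fx; rewrite col_mxKu linearD/= linearZ/= => /eqP.
  by rewrite -subr_eq0 addrC addKr => /eqP ->; rewrite scaler0.
have := congr1 dsubmx fx; rewrite col_mxKd => xJ.
rewrite -[LHS]linearZ/=.
apply/colP => i; rewrite [RHS]mxE [in RHS]mxE.
have := congr1 (fun y : 'cV_n => y i 0) xJ.
rewrite [LHS]mxE => xJi.
rewrite /v mxE /J in xJi *.
case: (cid _) xJi => w /= wE wx.
have : dsubmx (u x) i 0 = dsubmx x i 0 + dsubmx (l *: (M *m x + b)) i 0.
  by rewrite /u linearD/= [LHS]mxE.
by rewrite -wE wx => /addrI ->.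
Qed.

End ReducedEquilibrium.

(** * The scalar inequality behind the separation of time scales *)

(** [a], [b], [w] stand for the norms of the deviations in [r], [v] and the fast variable, [e] for
    the linearization error, [g] for the leakage increment. The tolerance [d] may depend on [eps],
    as the basin may shrink with [eps], but [eps_star] must not depend on [d]. *)
Lemma two_scale_bound (R : realType) (K kap mu L : R) :
  0 < K -> 0 < kap -> 0 < mu -> 0 < L ->
  exists2 eps_star, 0 < eps_star & forall eps, 0 < eps < eps_star ->
  exists2 d, 0 < d & forall a b w e g, 0 <= a -> 0 <= b -> 0 <= w -> 0 <= e ->
    e <= d * b -> g <= L * b ->
    - mu * (a ^+ 2 + b ^+ 2) + K * (e * (a + b) + w * (a + b + w + e + g)) +
      eps^-1 * (- kap * w ^+ 2 + K * (e * w)) <=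
    - (mu / 2) * (a ^+ 2 + b ^+ 2) - w ^+ 2.
Proof.
move=> K0 kap0 mu0 L0; pose M := K * (3 + L).
have M0 : 0 < M by rewrite mulr_gt0//; lra.
(* The coefficients of [w ^+ 2] to be absorbed: [K] from [w * w], [2 * M ^+ 2 / mu] from Young's
   inequality [h4], and [1] left over as decrease. *)
pose D := K + 2 * M ^+ 2 / mu + 1.
have D0 : 0 < D.
  have : 0 < 2 * M ^+ 2 / mu by rewrite divr_gt0// mulr_gt0// exprn_gt0.
  by rewrite /D; lra.
exists (kap / D); first by rewrite divr_gt0.
move=> eps /andP[eps0 epslt].
have Deps : D <= eps^-1 * kap.
  by rewrite mulrC ler_pdivlMr// mulrC -ler_pdivlMr// ltW.
(* [d <= eps] compensates the factor [1 / eps] in front of [e * w]. *)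
pose d := Num.min eps (Num.min 1 (mu / (8 * K))).
exists d; first by rewrite !lt_min eps0 ltr01 divr_gt0// mulr_gt0.
move=> a b w e g a0 b0 w0 e0 ed gL.
have [deps [d1 dmu]] : d <= eps /\ d <= 1 /\ K * d <= mu / 8.
  have -> : (K * d <= mu / 8) = (d <= mu / (8 * K)).
    have -> : mu / (8 * K) = mu / 8 / K by field; rewrite gt_eqF.
    by rewrite [RHS]ler_pdivlMr// mulrC.
  by rewrite !ge_min !lexx !orbT.
(* One quarter of [mu] is spent here and another in [h4], which leaves the [mu / 2] of the
   conclusion. *)
have h1 : K * (e * (a + b)) <= mu / 4 * (a ^+ 2 + b ^+ 2).
  apply: (@le_trans _ _ (mu / 8 * (b * (a + b)))).
    apply: (@le_trans _ _ (K * d * (b * (a + b)))).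
      rewrite -mulrA ler_pM2l// mulrA ler_wpM2r//; lra.
    by rewrite ler_wpM2r// mulr_ge0//; lra.
  have : 0 <= mu * ((a - b) ^+ 2 + a ^+ 2).
    by rewrite mulr_ge0 ?(ltW mu0)// addr_ge0 ?sqr_ge0.
  nra.
have eb : e <= b by apply: le_trans ed _; rewrite ler_piMl.
have h2 : K * (w * (a + b + w + e + g)) <= K * w ^+ 2 + K * (2 + L) * (w * (a + b)).
  have -> : K * w ^+ 2 + K * (2 + L) * (w * (a + b)) =
    K * (w * (w + (2 + L) * (a + b))) by ring.
  rewrite ler_pM2l// ler_wpM2l//.
  have : 0 <= L * a by rewrite mulr_ge0// ltW.
  by lra.
have h3 : eps^-1 * (K * (e * w)) <= K * (w * (a + b)).
  have -> : eps^-1 * (K * (e * w)) = K * (w * (e / eps)) by ring.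
  rewrite ler_pM2l// ler_wpM2l// ler_pdivrMr//.
  have d0 : 0 <= d by rewrite !le_min (ltW eps0) ler01 divr_ge0 ?mulr_ge0// ltW.
  by apply: le_trans ed _; rewrite [d * b]mulrC ler_pM//; lra.
have h4 : M * (w * (a + b)) <= mu / 4 * (a ^+ 2 + b ^+ 2) + 2 * M ^+ 2 / mu * w ^+ 2.
  have : 0 <= mu * (a - b) ^+ 2 / 8 + (mu * (a + b) - 4 * M * w) ^+ 2 / (8 * mu).
    have mu8 : 0 <= 8 * mu by rewrite mulr_ge0// ltW.
    have muab : 0 <= mu * (a - b) ^+ 2 by rewrite mulr_ge0 ?sqr_ge0// ltW.
    by rewrite addr_ge0// divr_ge0// sqr_ge0.
  have -> : mu * (a - b) ^+ 2 / 8 + (mu * (a + b) - 4 * M * w) ^+ 2 / (8 * mu) =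
     mu / 4 * (a ^+ 2 + b ^+ 2) + 2 * M ^+ 2 / mu * w ^+ 2 - M * (w * (a + b)).
    by field; rewrite gt_eqF.
  by rewrite subr_ge0.
have h5 : D * w ^+ 2 <= eps^-1 * kap * w ^+ 2 by rewrite ler_wpM2r// sqr_ge0.
have -> : eps^-1 * (- kap * w ^+ 2 + K * (e * w)) =
  - (eps^-1 * kap * w ^+ 2) + eps^-1 * (K * (e * w)) by ring.
have h6 : M * (w * (a + b)) = K * (2 + L) * (w * (a + b)) + K * (w * (a + b)).
  by rewrite /M; ring.
have h7 : D * w ^+ 2 = K * w ^+ 2 + 2 * M ^+ 2 / mu * w ^+ 2 + w ^+ 2.
  by rewrite /D; ring.
rewrite mulrDr; lra.
Qed.

(** * Decrease of the Lyapunov function up to cross terms *)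

Section Dissipation.
Context {R : realType} (p n k : nat).
(* [A21], [A22] are the reduced blocks; [A22e] is the original one, which acts on
   the linearization error [e].  In [dissipation], [g] is the leakage increment
   and [F], [U] are the velocities of [r] and [tau v]. *)
Variables (A11 : 'M[R]_p) (A12 : 'M[R]_(p, n)) (A21 : 'M[R]_(n, p))
  (A22 A22e : 'M[R]_n) (B : 'M[R]_(n, k)) (C : 'M[R]_(k, n)) (Z : 'M[R]_k)
  (H1 : 'M[R]_(k, p)) (H2 : 'M[R]_(k, n)).
Variables (P : 'M[R]_p) (d lam : 'rV[R]_n) (Pz : 'M[R]_k).
Hypothesis lam_gt0 : forall i, 0 < lam 0 i.
Hypothesis Qneg : forall x, x != 0 ->
  bil (block_mx (P *m A11) (P *m A12) (diag_mx d *m A21) (diag_mx d *m A22)) x x < 0.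
Hypothesis PzZneg : forall y, y != 0 -> bil (Pz *m Z) y y < 0.
Hypothesis Psym : P^T = P.
Hypothesis Pzsym : Pz^T = Pz.

(** The matrix inequality is tested on [(r, diag_mx lam *m v)], the linearized voltage deviation,
    and invertibility of [diag_mx lam] turns the bound into one on [v]. *)
Lemma slow_le : exists2 mu, 0 < mu & forall r v,
  bil P (A11 *m r + A12 *m (diag_mx lam *m v)) r +
  bil (diag_mx d) (A21 *m r + A22 *m (diag_mx lam *m v)) (diag_mx lam *m v) <=
  - mu * (`|r| ^+ 2 + `|v| ^+ 2).
Proof.
have [c c0 Qc] := bil_le_neg Qneg.
have [J J0 hJ] := mulmx_le (diag_mx (\row_i (lam 0 i)^-1)).
pose J1 := 1 + J ^+ 2; have J10 : 0 < J1 by rewrite addr_gt0// exprn_gt0.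
exists (c / J1) => [|r v]; first by rewrite divr_gt0.
set q := diag_mx lam *m v.
have vJ : `|v| <= J * `|q|.
  suff {1}-> : v = diag_mx (\row_i (lam 0 i)^-1) *m q by exact: hJ.
  apply/colP => i; rewrite /q !mul_diag_mx !mxE.
  by rewrite mulKf// gt_eqF.
have := Qc (col_mx r q); rewrite bil_block.
rewrite bilC// [bil (diag_mx d) _ q]bilC ?tr_diag_mx//.
rewrite !bilDr !bilM !addrA => /le_trans; apply.
have rs : `|r| <= `|col_mx r q|.
  apply: norm_mx_le => // i j; rewrite -(col_mxEu r q); exact: entry_le_norm.
have qs : `|q| <= `|col_mx r q|.
  apply: norm_mx_le => // i j; rewrite -(col_mxEd r q); exact: entry_le_norm.
rewrite !mulNr lerN2 -mulrA ler_pM2l// ler_pdivrMl//.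
set s := `|col_mx r q| in rs qs *.
have s0 : 0 <= s by exact: normr_ge0.
have r2 : `|r| ^+ 2 <= s ^+ 2 by rewrite ler_pXn2r// ?nnegrE.
have v2 : `|v| ^+ 2 <= J ^+ 2 * s ^+ 2.
  rewrite -exprMn ler_pXn2r// ?nnegrE ?mulr_ge0 ?(ltW J0)//.
  by rewrite (le_trans vJ)// ler_pM2l.
by rewrite /J1 mulrDl mul1r lerD.
Qed.

(** The left side is half the derivative of the Lyapunov function. As [y] is measured from the
    linearized quasi-steady state, the factor [eps^-1] meets only [y] and the error [e]; the motion
    of that state contributes [H1 *m F] and [H2 *m U], free of [eps^-1]. *)
Lemma dissipation : exists K kap mu, [/\ 0 < K, 0 < kap, 0 < mu &
  forall eps r v y e g F U, 0 < eps ->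
  0 <= bil (diag_mx d) g (diag_mx lam *m v) ->
  F = A11 *m r + A12 *m (diag_mx lam *m v + e) ->
  U = A21 *m r + A22 *m (diag_mx lam *m v) + A22e *m e + B *m y - g ->
  bil P F r + bil (diag_mx d) U (diag_mx lam *m v) +
  bil Pz (eps^-1 *: (Z *m y + C *m e) - H1 *m F - H2 *m U) y <=
  - mu * (`|r| ^+ 2 + `|v| ^+ 2) +
  K * (`|e| * (`|r| + `|v|) + `|y| * (`|r| + `|v| + `|y| + `|e| + `|g|)) +
  eps^-1 * (- kap * `|y| ^+ 2 + K * (`|e| * `|y|))].
Proof.
have [mu mu0 hmu] := slow_le.
have [kap kap0 hkap] := bil_le_neg PzZneg.
have [K1 K10 hK1] := bil_le (A12^T *m P).
have [K2 K20 hK2] := bil_le (A22e^T *m (diag_mx d *m diag_mx lam)).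
have [K3 K30 hK3] := bil_le (B^T *m (diag_mx d *m diag_mx lam)).
have [K4 K40 hK4] := bil_le (C^T *m Pz).
have [K5 K50 hK5] := bil_le (H1^T *m Pz).
have [K6 K60 hK6] := bil_le (H2^T *m Pz).
have [K7 K70 hK7] := mulmx_le A11.
have [K8 K80 hK8] := mulmx_le (A12 *m diag_mx lam).
have [K9 K90 hK9] := mulmx_le A12.
have [L1 L10 hL1] := mulmx_le A21.
have [L2 L20 hL2] := mulmx_le (A22 *m diag_mx lam).
have [L3 L30 hL3] := mulmx_le A22e.
have [L4 L40 hL4] := mulmx_le B.
(* One constant for both velocities: [|F|] and [|U|] are at most [N * S]. The summand [1] is the
   coefficient of [g] in [U]. *)
pose N := K7 + K8 + K9 + L1 + L2 + L3 + L4 + 1.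
have N0 : 0 < N by rewrite /N; lra.
pose K := K1 + K2 + K3 + K4 + K5 * N + K6 * N.
have KN5 : 0 < K5 * N by rewrite mulr_gt0.
have KN6 : 0 < K6 * N by rewrite mulr_gt0.
exists K, kap, mu; split => //; first by rewrite /K; lra.
move=> eps r v y e g F U eps0; set q := diag_mx lam *m v => hg FE UE.
have leN c t : c <= N -> 0 <= t -> c * t <= N * t.
  by move=> cN t0; rewrite ler_wpM2r.
have a0 := normr_ge0 r; have b0 := normr_ge0 v; have w0 := normr_ge0 y.
have e0 := normr_ge0 e; have g0 := normr_ge0 g.
have NE : N = K7 + K8 + K9 + L1 + L2 + L3 + L4 + 1 by [].
have KE : K = K1 + K2 + K3 + K4 + K5 * N + K6 * N by [].
set S := `|r| + `|v| + `|y| + `|e| + `|g|.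
have FN : `|F| <= N * S.
  have -> : F = A11 *m r + (A12 *m diag_mx lam) *m v + A12 *m e.
    by rewrite FE mulmxDr /q mulmxA addrA.
  apply: le_trans (ler_normD _ _) _.
  apply: le_trans (lerD (ler_normD _ _) (lexx _)) _.
  apply: le_trans (lerD (lerD (hK7 _) (hK8 _)) (hK9 _)) _.
  have h7 := leN K7 _ ltac:(lra) a0; have h8 := leN K8 _ ltac:(lra) b0.
  have h9 := leN K9 _ ltac:(lra) e0.
  have hy : 0 <= N * `|y| by rewrite mulr_ge0// ltW.
  have hg' : 0 <= N * `|g| by rewrite mulr_ge0// ltW.
  rewrite /S !mulrDr; lra.
have UN : `|U| <= N * S.
  have -> : U = A21 *m r + (A22 *m diag_mx lam) *m v + A22e *m e + B *m y - g.
    by rewrite UE /q mulmxA.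
  apply: (@le_trans _ _ (L1 * `|r| + L2 * `|v| + L3 * `|e| + L4 * `|y| + `|g|)).
    rewrite (le_trans (ler_normB _ _))// lerD2r.
    rewrite (le_trans (ler_normD _ _))// lerD//.
    rewrite (le_trans (ler_normD _ _))// lerD//.
    by rewrite (le_trans (ler_normD _ _))// lerD.
  have h1 := leN L1 _ ltac:(lra) a0; have h2 := leN L2 _ ltac:(lra) b0.
  have h3 := leN L3 _ ltac:(lra) e0; have h4 := leN L4 _ ltac:(lra) w0.
  have h5 := leN 1 _ ltac:(lra) g0.
  rewrite /S !mulrDr; lra.
have EF : bil P F r = bil P (A11 *m r + A12 *m q) r + bil (A12^T *m P) e r.
  by rewrite FE mulmxDr addrA bilDl [bil P (A12 *m e) r]bilMl.
have EU : bil (diag_mx d) U q = bil (diag_mx d) (A21 *m r + A22 *m q) q +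
    bil (A22e^T *m (diag_mx d *m diag_mx lam)) e v +
    bil (B^T *m (diag_mx d *m diag_mx lam)) y v - bil (diag_mx d) g q.
  by rewrite UE 3!bilDl bilNl -!bilMl -!bilM.
have EY : bil Pz (eps^-1 *: (Z *m y + C *m e) - H1 *m F - H2 *m U) y =
    eps^-1 * (bil (Pz *m Z) y y + bil (C^T *m Pz) e y) -
    bil (H1^T *m Pz) F y - bil (H2^T *m Pz) U y.
  by rewrite 2!bilDl !bilNl bilZl bilDl -!bilMl -bilM (bilC y (Z *m y)).
rewrite EF EU EY.
have S0 : 0 <= S by rewrite /S; lra.
have := hmu r v; rewrite -/q => m0.
have m1 := le_trans (ler_norm _) (hK1 e r).
have m2 := le_trans (ler_norm _) (hK2 e v).
have m3 := le_trans (ler_norm _) (hK3 y v).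
have m4 := le_trans (ler_norm _) (hK4 e y).
have m5 : - bil (H1^T *m Pz) F y <= K5 * N * (`|y| * S).
  apply: le_trans (ler_norm _) _; rewrite normrN (le_trans (hK5 _ _))// -mulrA.
  by rewrite ler_pM2l// [`|y| * S]mulrC mulrA ler_wpM2r.
have m6 : - bil (H2^T *m Pz) U y <= K6 * N * (`|y| * S).
  apply: le_trans (ler_norm _) _; rewrite normrN (le_trans (hK6 _ _))// -mulrA.
  by rewrite ler_pM2l// [`|y| * S]mulrC mulrA ler_wpM2r.
have eps'0 : 0 < eps^-1 by rewrite invr_gt0.
have m7 : eps^-1 * (bil (Pz *m Z) y y + bil (C^T *m Pz) e y) <=
    eps^-1 * (- kap * `|y| ^+ 2 + K * (`|e| * `|y|)).
  rewrite ler_pM2l// lerD//; apply: le_trans m4 _.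
  by rewrite ler_wpM2r ?mulr_ge0//; lra.
have m12 : K1 * (`|e| * `|r|) + K2 * (`|e| * `|v|) <= K * (`|e| * (`|r| + `|v|)).
  by rewrite !mulrDr lerD// ler_wpM2r ?mulr_ge0//; lra.
have m356 : K3 * (`|y| * `|v|) + K5 * N * (`|y| * S) + K6 * N * (`|y| * S) <=
    K * (`|y| * S).
  apply: (@le_trans _ _ ((K3 + K5 * N + K6 * N) * (`|y| * S))).
    rewrite !mulrDl !lerD2r ler_pM2l// ler_wpM2l// /S; lra.
  by rewrite ler_wpM2r ?mulr_ge0//; lra.
rewrite [K * (_ + `|y| * S)]mulrDr; lra.
Qed.

End Dissipation.

(** * Quadratic forms of linear functions of the state *)

Section CurveForms.
Context {R : realType} {E : normedModType R} (m : nat).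
Variables (l : E -> 'cV[R]_m) (K : R) (P : 'M[R]_m) (c : 'cV[R]_m).
Hypothesis l_lin : linear l.
Hypothesis K_gt0 : 0 < K.
Hypothesis l_le : forall x, `|l x| <= K * `|x|.

Lemma form_linear_continuous : continuous (fun x => bil P (l x - c) (l x - c)).
Proof.
move=> x; apply: (@continuous_comp _ _ _ (fun x => l x - c) (fun y => bil P y y)).
  apply: continuousB; last exact: cvg_cst.
  exact: (linear_map_continuous l_lin K_gt0 l_le).
exact: bil_continuous.
Qed.

Lemma is_derive_form_linear (x : R -> E) (t : R) e :
  P^T = P -> is_derive t 1 x e ->
  is_derive t 1 (fun s => bil P (l (x s) - c) (l (x s) - c))
    (2 * bil P (l e) (l (x t) - c)).
Proof.
move=> Psym dx; apply: is_derive_form => //.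
have dl := is_derive_linear l_lin K_gt0 l_le dx.
by apply: is_derive_eq; rewrite subr0.
Qed.

End CurveForms.

(** * Local bounds for entrywise nonlinearities *)

Section Linearization.
Context {R : realType} (n : nat).

Lemma derive_linearization (f : R -> R) (v s e : R) :
  is_derive v 1 f s -> 0 < e ->
  \forall w \near v, `|f w - f v - s * (w - v)| <= e * `|w - v|.
Proof.
move=> [df <-] e0.
have /cvgrPdist_le/(_ e e0) : h^-1 *: (f (h *: 1 + v) - f v) @[h --> 0^'] -->
  'D_1 f v by exact: df.
move=> /nbhs_ballP[r /= r0 hr]; apply/nbhs_ballP; exists r => //= w.
rewrite /ball/= distrC => wr.
have [->|wv] := eqVneq w v; first by rewrite !subrr mulr0 subr0 !normr0 mulr0.
have wv0 : w - v != 0 by rewrite subr_eq0.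
have := hr (w - v); rewrite /ball/= sub0r normrN => /(_ wr wv0).
rewrite /GRing.scale/= mulr1 subrK => h.
have -> : f w - f v - 'D_1 f v * (w - v) =
    - (('D_1 f v - (w - v)^-1 * (f w - f v)) * (w - v)) by field.
by rewrite normrN normrM ler_wpM2r.
Qed.

Lemma colmap_linearization (sig : 'I_n -> R -> R) (vb : 'cV[R]_n) (lam : 'rV[R]_n) e :
  (forall i, is_derive (vb i 0) 1 (sig i) (lam 0 i)) -> 0 < e ->
  exists2 r, 0 < r & forall v, `|v - vb| < r ->
    `|colmap sig v - colmap sig vb - diag_mx lam *m (v - vb)| <= e * `|v - vb|.
Proof.
move=> ds e0.
have : \forall v \near vb, forall i, `|sig i ((v : 'cV_n) i 0) - sig i (vb i 0) -
    lam 0 i * (v i 0 - vb i 0)| <= e * `|v i 0 - vb i 0|.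
  have near_i i := @coord_continuous R n 1 i 0 vb _ (derive_linearization (ds i) e0).
  exact: (@filter_forall _ _ _ _ _ near_i).
move=> /nbhs_normP[r /= r0 hr]; exists r => // v vr.
apply: norm_mx_le => [|i j]; first by rewrite mulr_ge0// ltW.
rewrite ord1 mul_diag_mx !mxE; apply: le_trans (hr v _ i) _.
  by rewrite /ball_/= distrC.
rewrite ler_pM2l//; have := entry_le_norm (v - vb) i 0; by rewrite !mxE.
Qed.

Lemma colmap_lipschitz (phi : 'I_n -> R -> R) (vb : 'cV[R]_n) :
  (forall i v, exists2 L, 0 < L &
    forall w, `|w - v| <= 1 -> `|phi i w - phi i v| <= L * `|w - v|) ->
  exists2 L, 0 < L & forall v, `|v - vb| <= 1 ->
    `|colmap phi v - colmap phi vb| <= L * `|v - vb|.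
Proof.
move=> philip; pose L i := s2val (cid2 (philip i (vb i 0))).
have L0 i : 0 < L i by rewrite /L; case: cid2.
have LP i w : `|w - vb i 0| <= 1 ->
    `|phi i w - phi i (vb i 0)| <= L i * `|w - vb i 0|.
  by rewrite /L; case: cid2 => /= x _; exact.
(* The sum dominates each [L i]; the [1] keeps it positive when there is no index. *)
exists (1 + \sum_i L i) => [|v v1].
  by rewrite ltr_pwDl// sumr_ge0// => i _; rewrite ltW.
have S0 : 0 <= 1 + \sum_i L i.
  by rewrite addr_ge0// sumr_ge0// => i _; rewrite ltW.
apply: norm_mx_le => [|i j]; first by rewrite mulr_ge0.
have vi : `|v i 0 - vb i 0| <= `|v - vb|.
  by have := entry_le_norm (v - vb) i 0; rewrite !mxE.
rewrite ord1 !mxE (le_trans (LP _ _ (le_trans vi v1)))// ler_pM ?(ltW (L0 i))//.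
rewrite (bigD1 i)//= addrCA lerDl addr_ge0// sumr_ge0// => h _; exact: ltW.
Qed.

End Linearization.

(** * Equilibrium and stability of an abstract fast-slow system *)

Section FastSlow.
Context {R : realType} (p n k : nat).
Variables (A11 : 'M[R]_p) (A12 : 'M[R]_(p, n)) (A21 : 'M[R]_(n, p))
  (A22 : 'M[R]_n) (B : 'M[R]_(n, k)) (C1 : 'M[R]_(k, p)) (C2 : 'M[R]_(k, n))
  (Z : 'M[R]_k) (b1 : 'cV[R]_p) (b2 : 'cV[R]_n) (b3 : 'cV[R]_k).
Variables (sig phi : 'I_n -> R -> R) (tau : R).

(** The closed loop with its matrices left arbitrary: graph and coordinates enter only through
    hypotheses on the blocks. [phi] plays the role of the whole product of leakage coefficient and
    state. *)
Definition fast_slow (eps : R) (x : 'cV[R]_p * 'cV[R]_n * 'cV[R]_k) :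
    'cV[R]_p * 'cV[R]_n * 'cV[R]_k :=
  let: (r, v, z) := x in
  (A11 *m r + A12 *m colmap sig v + b1,
   tau^-1 *: (A21 *m r + A22 *m colmap sig v + B *m z - colmap phi v + b2),
   eps^-1 *: (C1 *m r + C2 *m colmap sig v + Z *m z + b3)).

Let A21n := A21 - B *m invmx Z *m C1.
Let A22n := A22 - B *m invmx Z *m C2.

Variables (P : 'M[R]_p) (d : 'rV[R]_n) (Pz : 'M[R]_k).
Hypothesis sig_derive : forall i (v : R), exists2 s, 0 < s & is_derive v 1 (sig i) s.
Hypothesis sig_cont : forall i, continuous (sig i).
Hypothesis sig_homo : forall i, {homo sig i : x y / x < y}.
Hypothesis phi_cont : forall i, continuous (phi i).
Hypothesis phi_homo : forall i, {homo phi i : x y / x <= y}.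
Hypothesis phi_up : forall i c, exists2 v, 0 <= v & c <= phi i v.
Hypothesis phi_down : forall i c, exists2 v, v <= 0 & phi i v <= c.
Hypothesis phi_lip : forall i v, exists2 L, 0 < L &
  forall w, `|w - v| <= 1 -> `|phi i w - phi i v| <= L * `|w - v|.
Hypothesis tau_gt0 : 0 < tau.
Hypothesis Psym : P^T = P.
Hypothesis Ppos : forall x, x != 0 -> 0 < bil P x x.
Hypothesis d_gt0 : forall i, 0 < d 0 i.
Hypothesis Qneg : forall x, x != 0 ->
  bil (block_mx (P *m A11) (P *m A12) (diag_mx d *m A21n) (diag_mx d *m A22n)) x x
    < 0.
Hypothesis Zunit : Z \in unitmx.
Hypothesis Pzsym : Pz^T = Pz.
Hypothesis Pzpos : forall y, y != 0 -> 0 < bil Pz y y.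
Hypothesis PzZneg : forall y, y != 0 -> bil (Pz *m Z) y y < 0.

Lemma fast_slow_eq0 eps r v z : 0 < eps ->
  fast_slow eps (r, v, z) = 0 <->
  [/\ A11 *m r + A12 *m colmap sig v + b1 = 0,
    A21 *m r + A22 *m colmap sig v + B *m z - colmap phi v + b2 = 0 &
    C1 *m r + C2 *m colmap sig v + Z *m z + b3 = 0].
Proof.
move=> eps0; split=> [[e1 /eqP e2 /eqP e3]|[e1 e2 e3]].
  move: e2 e3; rewrite !scaler_eq0 !invr_eq0 !gt_eqF//= => /eqP e2 /eqP e3.
  by split.
by rewrite /fast_slow e1 e2 e3 !scaler0.
Qed.

(** Schur elimination: since [Z] is invertible, the third equation determines [z], and substituting
    it in the second yields the blocks [A21n] and [A22n]. *)
Lemma fast_slow_reduced eps r v z : 0 < eps ->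
  fast_slow eps (r, v, z) = 0 <->
  z = - (invmx Z *m (C1 *m r + C2 *m colmap sig v + b3)) /\
  block_mx A11 A12 A21n A22n *m col_mx r (colmap sig v) +
    col_mx b1 (b2 - B *m invmx Z *m b3) = col_mx 0 (colmap phi v).
Proof.
move=> eps0; rewrite fast_slow_eq0// mul_block_col add_col_mx.
set V := colmap sig v.
have zE : C1 *m r + C2 *m V + Z *m z + b3 = 0 <->
    z = - (invmx Z *m (C1 *m r + C2 *m V + b3)).
  rewrite addrAC; set u := _ + b3; split=> [/eqP|->].
    by rewrite addrC addr_eq0 => /eqP zu; rewrite -mulmxN -zu mulKmx.
  by rewrite mulmxN mulKVmx// subrr.
have redE : z = - (invmx Z *m (C1 *m r + C2 *m V + b3)) ->
    A21n *m r + A22n *m V + (b2 - B *m invmx Z *m b3) =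
    A21 *m r + A22 *m V + B *m z + b2.
  move=> ->; rewrite /A21n /A22n !mulmxBl mulmxN !mulmxDr !mulmxA.
  move: (A21 *m r) (A22 *m V) (B *m invmx Z *m C1 *m r)
    (B *m invmx Z *m C2 *m V) (B *m invmx Z *m b3) => a1 a2 a3 a4 a5.
  by apply/matrixP => i j; rewrite !mxE; ring.
split=> [[e1 e2 /zE ze]|[ze /eq_col_mx[e1 e2]]]; split => //.
- rewrite e1 redE//; congr col_mx; apply/eqP; rewrite -subr_eq0.
  by rewrite addrAC e2.
- by rewrite addrAC -redE// e2 subrr.
- exact/zE.
Qed.

Lemma sig_le i : {homo sig i : x y / x <= y}.
Proof. by move=> x y; rewrite le_eqVlt => /predU1P[->//|/sig_homo/ltW]. Qed.

Lemma sig_inj i : injective (sig i).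
Proof.
move=> x y xy; apply/eqP; case: ltgtP => // /(@sig_homo i); rewrite xy ltxx//.
Qed.

(** [eps] only rescales an equation, so one point serves all [eps]; this lets the slopes at the
    equilibrium be fixed before [eps] is chosen. *)
Lemma fast_slow_equilibrium :
  exists xbar, forall eps x, 0 < eps -> fast_slow eps x = 0 <-> x = xbar.
Proof.
set N := block_mx P 0 0 (diag_mx d); set M := block_mx A11 A12 A21n A22n.
have NME : N *m M =
    block_mx (P *m A11) (P *m A12) (diag_mx d *m A21n) (diag_mx d *m A22n).
  by rewrite mulmx_block !mul0mx !addr0 !add0r.
have [r [v rv]] := reduced_equilibrium sig_cont phi_cont sig_le phi_homo phi_up
  phi_down (M := M) (col_mx b1 (b2 - B *m invmx Z *m b3)) Psym Ppos d_gt0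
  ltac:(by rewrite -/N NME).
exists (r, v, - (invmx Z *m (C1 *m r + C2 *m colmap sig v + b3))).
move=> eps [[r' v'] z'] eps0.
split=> [/(fast_slow_reduced _ _ _ eps0)[zE' rv']|->]; last first.
  exact/fast_slow_reduced.
pose s := col_mx (r' - r) (colmap sig v' - colmap sig v).
have Ms : M *m s = col_mx 0 (colmap phi v' - colmap phi v).
  have -> : s = col_mx r' (colmap sig v') - col_mx r (colmap sig v).
    by rewrite opp_col_mx add_col_mx.
  rewrite mulmxBr -[M *m col_mx r' _](addrK (col_mx b1 (b2 - B *m invmx Z *m b3))).
  rewrite rv' -addrA -opprD [_ + M *m _]addrC rv.
  by rewrite opp_col_mx add_col_mx subr0.
(* The form of [N *m M] at [s] pairs increments of [sig] and [phi], which have equal signs; being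
   also negative unless [s = 0], it forces [s = 0]. *)
have s0 : s = 0.
  apply/eqP; apply/negPn/negP => /Qneg; rewrite -NME -bilM Ms bil_block bil_diag.
  apply/negP; rewrite -leNgt /bil !mulmx0 mul0mx !mxE !add0r.
  apply: sumr_ge0 => i _; rewrite mulr_ge0 ?(ltW (d_gt0 i))// !mxE.
  by have [h|/ltW h] := leP (v i 0) (v' i 0);
    [rewrite mulr_ge0|rewrite mulr_le0];
    rewrite // ?(subr_ge0, subr_le0) ?sig_le ?phi_homo.
have [/eqP + /eqP] : r' - r = 0 /\ colmap sig v' - colmap sig v = 0.
  by move: s0; rewrite -[0]col_mx0 => /eq_col_mx.
rewrite !subr_eq0 => /eqP rr /eqP vv.
have v'v : v' = v.
  apply/colP => i; apply: (@sig_inj i).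
  by have := congr1 (fun u : 'cV_n => u i 0) vv; rewrite !mxE.
by rewrite zE' rr v'v.
Qed.

Lemma fast_slow_stable xbar : (forall eps, 0 < eps -> fast_slow eps xbar = 0) ->
  exists2 eps_star, 0 < eps_star & forall eps, 0 < eps < eps_star ->
    exponentially_stable (fast_slow eps) xbar.
Proof.
move: xbar => [[rb vb] zb] eqb.
pose lam : 'rV[R]_n := \row_i s2val (cid2 (sig_derive i (vb i 0))).
have lam0 i : 0 < lam 0 i by rewrite mxE; case: cid2.
have dlam i : is_derive (vb i 0) 1 (sig i) (lam 0 i).
  by rewrite mxE; case: cid2.
pose H1 := - (invmx Z *m C1); pose H2 := - (invmx Z *m C2 *m diag_mx lam).
(* In [dissipation] the velocity [U] is [tau] times that of [v], hence the factor [tau^-1] on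
   [H2]. *)
have [K [kap [mu [K0 kap0 mu0 diss]]]] := @dissipation R p n k A11 A12
  A21n A22n A22 B C2 Z H1 (tau^-1 *: H2) P d lam Pz lam0 Qneg PzZneg Psym Pzsym.
have [L L0 lip] := colmap_lipschitz vb phi_lip.
have [es es0 hes] := two_scale_bound K0 kap0 mu0 L0.
exists es => // eps /[dup] /andP[eps0 _] /hes[dl dl0 bnd].
(* The tolerance [dl], and with it the radius [r1], depends on [eps]; only [es] has to be
   uniform. *)
have [r1 r10 hr1] := colmap_linearization dlam dl0.
pose E := ('cV[R]_p * 'cV[R]_n * 'cV[R]_k)%type.
pose lr (x : E) := x.1.1; pose lv (x : E) := x.1.2.
pose ly (x : E) := x.2 - H1 *m x.1.1 - H2 *m x.1.2.
have lr_lin : linear lr by move=> c x y.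
have lv_lin : linear lv by move=> c x y.
have ly_lin : linear ly.
  move=> c x y; rewrite /ly/= !mulmxDr -!scalemxAr.
  move: (H1 *m _) (H1 *m _) (H2 *m _) (H2 *m _) x.2 y.2 => a1 a2 a3 a4 a5 a6.
  by apply/matrixP => i j; rewrite !mxE; ring.
have lr_le x : `|lr x| <= 1 * `|x|.
  by rewrite mul1r !prod_normE !le_max lexx.
have lv_le x : `|lv x| <= 1 * `|x|.
  by rewrite mul1r !prod_normE !le_max lexx orbT.
have lz_le (x : E) : `|x.2| <= `|x| by rewrite prod_normE le_max lexx orbT.
have [k1 k10 hk1] := mulmx_le H1; have [k2 k20 hk2] := mulmx_le H2.
have ly_le x : `|ly x| <= (1 + k1 + k2) * `|x|.
  rewrite !mulrDl (le_trans (ler_normB _ _))//.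
  rewrite lerD ?(le_trans (ler_normB _ _))//.
    rewrite lerD// ?mul1r//; apply: le_trans (hk1 _) _.
    by rewrite ler_pM2l// -[leRHS]mul1r lr_le.
  apply: le_trans (hk2 _) _; by rewrite ler_pM2l// -[leRHS]mul1r lv_le.
have k120 : 0 < 1 + k1 + k2 by lra.
pose xb : E := (rb, vb, zb).
(* [tau] cancels the [tau^-1] of the voltage equation, and the slopes replace [v] by its linearized
   voltage in the pairing with [diag_mx d]. *)
pose PL := tau *: diag_mx (\row_i (d 0 i * lam 0 i)).
have PLsym : PL^T = PL by rewrite linearZ/= tr_diag_mx.
pose W x := bil P (lr x - lr xb) (lr x - lr xb) +
  bil PL (lv x - lv xb) (lv x - lv xb) + bil Pz (ly x - ly xb) (ly x - ly xb).
pose dW x := 2 * bil P (lr (fast_slow eps x)) (lr x - lr xb) +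
  2 * bil PL (lv (fast_slow eps x)) (lv x - lv xb) +
  2 * bil Pz (ly (fast_slow eps x)) (ly x - ly xb).
have [q1 q10 hq1] := bil_ge Ppos.
have PLpos v : v != 0 -> 0 < bil PL v v.
  move=> v0; rewrite bilZ mulr_gt0// bil_diag_gt0// => i.
  by rewrite mxE mulr_gt0.
have [q2 q20 hq2] := bil_ge PLpos.
have [q3 q30 hq3] := bil_ge Pzpos.
have [Q1 Q10 hQ1] := bil_le P.
have [Q2 Q20 hQ2] := bil_le PL.
have [Q3 Q30 hQ3] := bil_le Pz.
(* The square comes from recovering [z] out of [(r, v, y)], the [3] from bounding the square of a
   sum of three terms by the sum of squares. *)
pose J := 3 * (1 + k1 + k2) ^+ 2.
have ly_sub x y : ly x - ly y = ly (x - y).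
  by rewrite [in RHS]addrC -[in RHS]scaleN1r ly_lin scaleN1r addrC.
have normJ x : `|x - xb| ^+ 2 <= J *
  (`|lr x - lr xb| ^+ 2 + `|lv x - lv xb| ^+ 2 + `|ly x - ly xb| ^+ 2).
  have zE : `|(x - xb).2| <=
      `|ly x - ly xb| + k1 * `|lr x - lr xb| + k2 * `|lv x - lv xb|.
    have -> : (x - xb).2 =
        (ly x - ly xb) + H1 *m (lr x - lr xb) + H2 *m (lv x - lv xb).
      by rewrite ly_sub /ly/= addrAC subrK subrK.
    rewrite (le_trans (ler_normD _ _))// lerD//.
    by rewrite (le_trans (ler_normD _ _))// lerD.
  have a0 := normr_ge0 (lr x - lr xb); have b0 := normr_ge0 (lv x - lv xb).
  have w0 := normr_ge0 (ly x - ly xb).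
  have xE : `|x - xb| <= (1 + k1 + k2) *
      (`|lr x - lr xb| + `|lv x - lv xb| + `|ly x - ly xb|).
    rewrite !prod_normE !ge_max -!andbA.
    move: zE a0 b0 w0; rewrite /lr/lv/=.
    set a := `|_ - rb|; set b := `|_ - vb|; set w := `|_ - ly xb|.
    move=> zE a0 b0 w0; apply/and3P.
    have := mulr_ge0 (ltW k10) a0; have := mulr_ge0 (ltW k10) b0.
    have := mulr_ge0 (ltW k10) w0; have := mulr_ge0 (ltW k20) a0.
    have := mulr_ge0 (ltW k20) b0; have := mulr_ge0 (ltW k20) w0.
    rewrite !mulrDr !mulrDl; split; lra.
  have -> : J = (1 + k1 + k2) ^+ 2 * 3 by rewrite /J mulrC.
  rewrite -mulrA; apply: (@le_trans _ _ (((1 + k1 + k2) *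
      (`|lr x - lr xb| + `|lv x - lv xb| + `|ly x - ly xb|)) ^+ 2)).
    by rewrite ler_pXn2r// ?nnegrE// mulr_ge0 ?(ltW k120)// !addr_ge0.
  rewrite exprMn ler_pM2l ?exprn_gt0//.
  set a := `|_|; set b := `|_|; set w := `|_|.
  have := sqr_ge0 (a - b); have := sqr_ge0 (a - w); have := sqr_ge0 (b - w); nra.
have J0 : 0 < J by rewrite mulr_gt0// exprn_gt0.
pose q := Num.min q1 (Num.min q2 q3).
have q0 : 0 < q by rewrite !lt_min q10 q20.
have [qq1 [qq2 qq3]] : q <= q1 /\ q <= q2 /\ q <= q3.
  by rewrite !ge_min !lexx !orbT.
pose mu' := Num.min (mu / 2) 1.
have mu'0 : 0 < mu' by rewrite lt_min divr_gt0// ltr01.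
have [mu'1 mu'2] : mu' <= mu / 2 /\ mu' <= 1 by rewrite !ge_min !lexx !orbT.
(* The radius combines the distance [1] allowed by the Lipschitz bound on [phi] with the radius [r1]
   of the linearization; the [2] in the rate is that of differentiating a square. *)
apply: (@lyapunov_exponentially_stable R E (fast_slow eps) xb W dW (q / J)
  (Q1 + Q2 + Q3 * (1 + k1 + k2) ^+ 2) (2 * mu' / J) (Num.min 1 r1)).
- by rewrite divr_gt0.
- have : 0 < Q3 * (1 + k1 + k2) ^+ 2 by rewrite mulr_gt0// exprn_gt0.
  by lra.
- by rewrite divr_gt0// mulr_gt0.
- by rewrite lt_min ltr01.
- exact: eqb.
- move=> x.
  have c1 := form_linear_continuous (P := P) (c := lr xb) lr_lin ltr01 lr_le (x := x).
  have c2 := form_linear_continuous (P := PL) (c := lv xb) lv_lin ltr01 lv_le (x := x).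
  have c3 := form_linear_continuous (P := Pz) (c := ly xb) ly_lin k120 ly_le (x := x).
  exact: (cvgD (cvgD c1 c2) c3).
- move=> x; apply/andP; split.
    have := hq1 (lr x - lr xb); have := hq2 (lv x - lv xb).
    have := hq3 (ly x - ly xb); have := normJ x; rewrite /W.
    set a := `|lr x - lr xb| ^+ 2; set b := `|lv x - lv xb| ^+ 2.
    set w := `|ly x - ly xb| ^+ 2 => hJ h3 h2 h1.
    apply: (@le_trans _ _ (q * (a + b + w))).
      by rewrite -mulrA ler_pM2l// ler_pdivrMl.
    rewrite !mulrDr !lerD//; [apply: le_trans h1|apply: le_trans h2|apply: le_trans h3];
      by rewrite ler_wpM2r// exprn_ge0.
  have h1 := le_trans (ler_norm _) (hQ1 (lr x - lr xb) (lr x - lr xb)).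
  have h2 := le_trans (ler_norm _) (hQ2 (lv x - lv xb) (lv x - lv xb)).
  have h3 := le_trans (ler_norm _) (hQ3 (ly x - ly xb) (ly x - ly xb)).
  rewrite -!expr2 in h1 h2 h3; rewrite /W !mulrDl.
  apply: lerD; [apply: lerD|].
  + apply: le_trans h1 _; rewrite ler_pM2l// ler_pXn2r ?nnegrE//.
    by have := lr_le (x - xb); rewrite mul1r.
  + apply: le_trans h2 _; rewrite ler_pM2l// ler_pXn2r ?nnegrE//.
    by have := lv_le (x - xb); rewrite mul1r.
  + apply: le_trans h3 _; rewrite -mulrA ler_pM2l// -exprMn.
    by rewrite ler_pXn2r ?nnegrE ?mulr_ge0 ?(ltW k120)// ly_sub.
- move=> x t dx; rewrite /W /dW.
  have dr := is_derive_form_linear (lr xb) lr_lin ltr01 lr_le Psym dx.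
  have dv := is_derive_form_linear (lv xb) lv_lin ltr01 lv_le PLsym dx.
  have dy := is_derive_form_linear (ly xb) ly_lin k120 ly_le Pzsym dx.
  exact: is_deriveD.
(* Replacing [z] by its quasi-steady value plus [y] turns [A21], [A22] into the reduced blocks,
   except on the error [e], where [A22] remains. *)
- have slowE r v y e g : A21 *m r + A22 *m (diag_mx lam *m v + e) +
      B *m (y + H1 *m r + H2 *m v) - g =
      A21n *m r + A22n *m (diag_mx lam *m v) + A22 *m e + B *m y - g.
    rewrite /A21n /A22n /H1 /H2 !mulmxDr !mulmxBl !mulNmx !mulmxN !mulmxA.
    move: (A21 *m r) (A22 *m diag_mx lam *m v) (A22 *m e) (B *m y)
      (B *m invmx Z *m C1 *m r) (B *m invmx Z *m C2 *m diag_mx lam *m v)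
      => u1 u2 u3 u4 u5 u6.
    by apply/matrixP => i j; rewrite !mxE; ring.
  have fastE y r v : Z *m y =
      Z *m (y + H1 *m r + H2 *m v) + C1 *m r + C2 *m (diag_mx lam *m v).
    rewrite !mulmxDr /H1 /H2 !mulNmx !mulmxN -!mulmxA !mulKVmx//.
    move: (Z *m y) (C1 *m r) (C2 *m _) => u1 u2 u3.
    by apply/matrixP => i j; rewrite !mxE; ring.
  move=> x; rewrite lt_min => /andP[x1 xr1].
  pose r := lr x - lr xb; pose v := lv x - lv xb; pose y := ly x - ly xb.
  pose e := colmap sig (lv x) - colmap sig vb - diag_mx lam *m v.
  pose g := colmap phi (lv x) - colmap phi vb.
  have vx : `|v| <= `|x - xb| by have := lv_le (x - xb); rewrite mul1r.
  have ev : `|e| <= dl * `|v| by apply: hr1; exact: le_lt_trans vx xr1.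
  have gv : `|g| <= L * `|v| by apply: lip; rewrite (le_trans vx)// ltW.
  have fsE : fast_slow eps x = (A11 *m lr x + A12 *m colmap sig (lv x) + b1,
      tau^-1 *: (A21 *m lr x + A22 *m colmap sig (lv x) + B *m x.2 -
        colmap phi (lv x) + b2),
      eps^-1 *: (C1 *m lr x + C2 *m colmap sig (lv x) + Z *m x.2 + b3)).
    by rewrite /lr /lv; case: (x) => [[]].
  (* Each entry of [g] has the sign of the same entry of [v], and all weights are diagonal and
     positive. *)
  have hg : 0 <= bil (diag_mx d) g (diag_mx lam *m v).
    rewrite bil_diag; apply: sumr_ge0 => i _; rewrite mul_diag_mx.
    have -> : (\matrix_(i, j) (lam 0 i * v i j)) i 0 = lam 0 i * v i 0.
      by rewrite mxE.
    rewrite mulr_ge0 ?(ltW (d_gt0 i))// mulrCA mulr_ge0 ?(ltW (lam0 i))// !mxE.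
    by have [h|/ltW h] := leP (vb i 0) (lv x i 0);
      [rewrite mulr_ge0|rewrite mulr_le0];
      rewrite // ?(subr_ge0, subr_le0) ?phi_homo.
  (* Subtracting the equilibrium equations removes the offsets and leaves deviations only. *)
  have [eq1 eq2 eq3] := (fast_slow_eq0 rb vb zb eps0).1 (eqb _ eps0).
  have qe : diag_mx lam *m v + e = colmap sig (lv x) - colmap sig vb.
    by rewrite addrC subrK.
  have hF : lr (fast_slow eps x) = A11 *m r + A12 *m (diag_mx lam *m v + e).
    rewrite qe fsE /lr/= -[LHS]subr0 -eq1 !mulmxBr.
    move: (A11 *m _) (A11 *m _) (A12 *m _) (A12 *m _) => u1 u2 u3 u4.
    by apply/matrixP => i j; rewrite !mxE; ring.
  have z_y : x.2 - zb = y + H1 *m r + H2 *m v.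
    by rewrite /y ly_sub /ly/= addrAC subrK subrK.
  have hU : tau *: lv (fast_slow eps x) = A21n *m r + A22n *m (diag_mx lam *m v) +
      A22 *m e + B *m y - g.
    have -> : tau *: lv (fast_slow eps x) = A21 *m r +
        A22 *m (colmap sig (lv x) - colmap sig vb) + B *m (x.2 - zb) - g.
      rewrite fsE /lv/= scalerA mulfV ?gt_eqF// scale1r -[LHS]subr0 -eq2 !mulmxBr.
      rewrite /g /lr.
      move: (A21 *m _) (A21 *m _) (A22 *m _) (A22 *m _) (B *m _) (B *m _)
        (colmap phi _) (colmap phi _) => u1 u2 u3 u4 u5 u6 u7 u8.
      by apply/matrixP => i j; rewrite !mxE; ring.
    by rewrite -qe z_y slowE.
  have hY : ly (fast_slow eps x) = eps^-1 *: (Z *m y + C2 *m e) -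
      H1 *m lr (fast_slow eps x) - (tau^-1 *: H2) *m (tau *: lv (fast_slow eps x)).
    have -> : (tau^-1 *: H2) *m (tau *: lv (fast_slow eps x)) =
        H2 *m lv (fast_slow eps x).
      by rewrite -scalemxAl -scalemxAr scalerA mulVf ?gt_eqF// scale1r.
    rewrite /ly; congr (_ - _ - _); rewrite fsE /=; congr (_ *: _).
    have -> : C2 *m e = C2 *m (colmap sig (lv x) - colmap sig vb) -
        C2 *m (diag_mx lam *m v).
      by rewrite -qe mulmxDr [RHS]addrAC subrr add0r.
    rewrite (fastE _ y r v) -z_y.
    rewrite -[LHS]subr0 -eq3 !mulmxBr.
    move: (C1 *m _) (C1 *m _) (C2 *m _) (C2 *m _) (C2 *m _) (Z *m _) (Z *m _)
      => u1 u2 u3 u4 u5 u6 u7.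
    by apply/matrixP => i j; rewrite !mxE; ring.
  have := diss eps r v y e g _ _ eps0 hg hF hU; rewrite -hY.
  have -> : bil (diag_mx d) (tau *: lv (fast_slow eps x)) (diag_mx lam *m v) =
      bil PL (lv (fast_slow eps x)) v.
    rewrite bilZl bilZ !bil_diag; congr (_ * _); apply: eq_bigr => i _.
    by rewrite mul_diag_mx [in LHS]mxE [X in _ = X * _]mxE; ring.
  have := bnd _ _ _ _ _ (normr_ge0 r) (normr_ge0 v) (normr_ge0 y) (normr_ge0 e) ev gv.
  move=> h1 h2; have := le_trans h2 h1; have := normJ x.
  rewrite /dW -/r -/v -/y -!mulrDr -mulrA mulNr.
  set Wd := _ + _ + bil Pz _ _ => hJ hW.
  have a0 : 0 <= `|r| ^+ 2 by rewrite exprn_ge0.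
  have b0 : 0 <= `|v| ^+ 2 by rewrite exprn_ge0.
  have w0 : 0 <= `|y| ^+ 2 by rewrite exprn_ge0.
  have hJ' : mu' / J * `|x - xb| ^+ 2 <= mu' * (`|r| ^+ 2 + `|v| ^+ 2 + `|y| ^+ 2).
    by rewrite -mulrA ler_pM2l// ler_pdivrMl.
  have h3 : mu' * (`|r| ^+ 2 + `|v| ^+ 2) <= mu / 2 * (`|r| ^+ 2 + `|v| ^+ 2).
    by rewrite ler_wpM2r// addr_ge0.
  have h4 : mu' * `|y| ^+ 2 <= `|y| ^+ 2 by rewrite ler_piMl.
  rewrite mulrDr in hJ'; lra.
Qed.

End FastSlow.

(** * Invertibility from kernels and forms *)

Section Invertibility.
Context {R : realType} (n : nat).

(** [kermx] is the kernel on row vectors, so the argument runs on the transpose. *)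
Lemma unitmx_ker0 (A : 'M[R]_n) :
  (forall x : 'cV_n, A *m x = 0 -> x = 0) -> A \in unitmx.
Proof.
move=> A0; rewrite -unitmx_tr -row_free_unit -kermx_eq0.
apply/negPn/negP => /rowV0Pn[v /sub_kermxP vA /negP]; apply; apply/eqP.
apply: (can_inj (@trmxK _ _ _)); rewrite trmx0; apply: A0.
by rewrite -[A]trmxK -trmx_mul vA trmx0.
Qed.

Lemma unitmx_form (A : 'M[R]_n) : (forall x, x != 0 -> bil A x x != 0) ->
  A \in unitmx.
Proof.
move=> A0; apply: unitmx_ker0 => x Ax; apply/eqP/negPn/negP => /A0/eqP; apply.
by rewrite /bil -mulmxA Ax mulmx0 mxE.
Qed.

Lemma bil1_gt0 (x : 'cV[R]_n) : x != 0 -> 0 < bil 1%:M x x.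
Proof.
by move=> x0; rewrite -diag_const_mx; apply: bil_diag_gt0 => // i; rewrite mxE.
Qed.

End Invertibility.

(** * The graph Laplacian and its resolvent *)

Section Laplacian.
Context {R : realType} (n : nat) (e : rel 'I_n).
Hypothesis e_sym : symmetric e.

Let L : 'M[R]_n := laplacian e.

Lemma laplacian_sym : L^T = L.
Proof.
rewrite /L /laplacian linearB/= tr_diag_mx; congr (_ - _).
by apply/matrixP => i j; rewrite !mxE e_sym.
Qed.

Lemma laplacian_const m : L *m (const_mx 1 : 'M[R]_(n, m)) = 0.
Proof.
rewrite /L /laplacian mulmxBl mul_diag_mx; apply/matrixP => i j; rewrite !mxE.
rewrite mulr1; apply/eqP; rewrite subr_eq0; apply/eqP/eq_bigr => k _.
by rewrite !mxE mulr1.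
Qed.

(** The Dirichlet form. The sum over ordered pairs meets each edge twice, whence the [2]; symmetry
    of the graph identifies the two sums of squares. *)
Lemma laplacian_form (x : 'cV[R]_n) :
  2 * bil L x x = \sum_i \sum_j (e i j)%:R * (x i 0 - x j 0) ^+ 2.
Proof.
have LE : bil L x x = \sum_i \sum_j (e i j)%:R * (x i 0 ^+ 2) -
    \sum_i \sum_j (e i j)%:R * (x i 0 * x j 0).
  rewrite /L /laplacian bilA bilN bil_diag bilE; congr (_ - _).
    apply: eq_bigr => i _; rewrite !mxE -expr2 mulr_suml.
    by apply: eq_bigr => j _; rewrite !mxE.
  apply: eq_bigr => i _; apply: eq_bigr => j _; rewrite !mxE; ring.
have swapE : \sum_i \sum_j (e i j)%:R * (x i 0 ^+ 2) =
    \sum_i \sum_j (e i j)%:R * (x j 0 ^+ 2).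
  rewrite exchange_big/=; apply: eq_bigr => i _; apply: eq_bigr => j _.
  by rewrite e_sym.
have -> : 2 * bil L x x = \sum_i \sum_j (e i j)%:R * (x i 0 ^+ 2) +
    \sum_i \sum_j (e i j)%:R * (x j 0 ^+ 2) -
    2 * (\sum_i \sum_j (e i j)%:R * (x i 0 * x j 0)).
  by rewrite LE -swapE; ring.
rewrite mulr_sumr -sumrN -!big_split/=; apply: eq_bigr => i _.
rewrite mulr_sumr -sumrN -!big_split/=; apply: eq_bigr => j _; ring.
Qed.

Lemma laplacian_ge0 x : 0 <= bil L x x.
Proof.
rewrite -(@pmulr_rge0 _ 2)// laplacian_form; apply: sumr_ge0 => i _.
by apply: sumr_ge0 => j _; rewrite mulr_ge0// sqr_ge0.
Qed.

(** Every term of the Dirichlet form vanishes, so [x] agrees across each edge, and then along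
    paths. *)
Lemma laplacian_ker (x : 'cV[R]_n) : (forall i j, connect e i j) -> L *m x = 0 ->
  forall i j, x i 0 = x j 0.
Proof.
move=> e_conn Lx.
have term_ge0 i j : 0 <= (e i j)%:R * (x i 0 - x j 0) ^+ 2.
  by rewrite mulr_ge0// sqr_ge0.
have e_eq i j : e i j -> x i 0 = x j 0.
  move=> eij; have : 2 * bil L x x = 0 by rewrite /bil -mulmxA Lx mulmx0 mxE mulr0.
  rewrite laplacian_form => /psumr_eq0P h.
  have /psumr_eq0P h' := h (fun i _ => sumr_ge0 _ (fun j _ => term_ge0 i j)) i isT.
  have /eqP := h' (fun j _ => term_ge0 i j) j isT.
  by rewrite eij mul1r sqrf_eq0 subr_eq0 => /eqP.
move=> i j; have /connectP[p + ->] := e_conn i j.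
elim: p i => //= a p IH i /andP[/e_eq -> /IH].
by [].
Qed.

Lemma resolvent_posdef (k : R) : 0 < k -> forall x, x != 0 ->
  0 < bil (1%:M + k *: L) x x.
Proof.
move=> k0 x x0; rewrite bilA bilZ ltr_wpDr ?bil1_gt0//.
by rewrite mulr_ge0 ?laplacian_ge0// ltW.
Qed.

(** With [A = 1%:M + k *: L], the form of [invmx A] at [x] is the form of [A] at [invmx A *m x]. *)
Lemma invmx_resolvent_posdef (k : R) : 0 < k -> forall x, x != 0 ->
  0 < bil (invmx (1%:M + k *: L)) x x.
Proof.
move=> k0 x x0; set A := 1%:M + k *: L.
have Apos := resolvent_posdef k0.
have Au : A \in unitmx by apply: unitmx_form => y /Apos/lt0r_neq0.
have AV : A *m (invmx A *m x) = x by rewrite mulKVmx.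
rewrite -[invmx A]mul1mx -bilM -{1}AV -bil_tr trmx1 bilM mul1mx.
apply: Apos; apply: contra x0 => /eqP x0; by rewrite -AV x0 mulmx0.
Qed.

End Laplacian.

(** * The coordinate matrices [T] and [Ir] *)

Section Coordinates.
Context {R : realType} (n : nat).
Hypothesis n_gt0 : (0 < n)%N.

Let T : 'M[R]_n := Tmx n.
Let Ir : 'M[R]_(n.-1, n) := Irmx n.

(** The sum over [j] with [j.+1 = i] has a single term; this form avoids building the ordinal before
    [i]. *)
Lemma mul_Tmx (x : 'cV[R]_n) (i : 'I_n) :
  (T *m x) i 0 = if i == 0%N :> nat then n%:R^-1 * (\sum_j x j 0)
                 else x i 0 - \sum_(j < n | j.+1 == i :> nat) x j 0.
Proof.
rewrite mxE; case: ifP => i0.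
  by rewrite mulr_sumr; apply: eq_bigr => j _; rewrite mxE i0.
rewrite -sumrN [in RHS]big_mkcond/= (bigD1 i)//= [in RHS](bigD1 i)//=.
have -> : T i i = 1 by rewrite mxE i0 eqxx gtn_eqF.
rewrite [i.+1 == _ :> nat]gtn_eqF// add0r mul1r; congr (_ + _); apply: eq_bigr => j ji.
rewrite mxE i0; case: ifP => _; rewrite ?mulN1r//.
by rewrite (negbTE ji) mul0r.
Qed.

Lemma Tmx_const : T *m (const_mx 1 : 'cV_n) = \col_i (i == 0%N :> nat)%:R.
Proof.
apply/colP => i; rewrite mul_Tmx [RHS]mxE; case: ifP => i0.
  under eq_bigr do rewrite mxE.
  by rewrite sumr_const card_ord mulVf// pnatr_eq0 -lt0n.
have [i' i'E] : exists i' : 'I_n, i'.+1 = i :> nat.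
  have ilt : (i.-1 < n)%N by rewrite (leq_ltn_trans (leq_pred i)).
  by exists (Ordinal ilt) => /=; rewrite prednK// lt0n i0.
rewrite (bigD1 i')/= ?i'E// big1 ?addr0 ?mxE ?subrr// => j /andP[/eqP ji /eqP jn].
by case: jn; apply/val_inj/eq_add_S; rewrite ji i'E.
Qed.

(** On a kernel vector the difference rows make all entries equal, and the averaging row makes the
    common value zero. *)
Lemma Tmx_unit : T \in unitmx.
Proof.
apply: unitmx_ker0 => x Tx.
have xS (j i : 'I_n) : j.+1 = i :> nat -> x i 0 = x j 0.
  move=> ji; have := congr1 (fun y : 'cV_n => y i 0) Tx.
  rewrite mul_Tmx [RHS]mxE -{1}ji/= (bigD1 j)/= ?ji// big1.
    by rewrite addr0 => /eqP; rewrite subr_eq0 => /eqP.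
  move=> h /andP[/eqP hi /eqP hn].
  by case: hn; apply/val_inj/eq_add_S; rewrite hi ji.
pose o := Ordinal n_gt0.
have xo i : x i 0 = x o 0.
  case: i; elim=> [|i IH] iP; first by congr (x _ _); exact: val_inj.
  by rewrite (xS (Ordinal (ltnW iP))).
have := congr1 (fun y : 'cV_n => y o 0) Tx.
rewrite mul_Tmx [RHS]mxE/= (eq_bigr (fun=> x o 0)) => [|i _]; last exact: xo.
rewrite sumr_const card_ord -[x o 0 *+ n]mulr_natl mulKf ?pnatr_eq0 -?lt0n// => x0.
by apply/colP => i; rewrite xo x0 mxE.
Qed.

Lemma Irmx_col (y : 'cV[R]_n.-1) (i : 'I_n.-1) (j : 'I_n) :
  j = i.+1 :> nat -> (Ir^T *m y) j 0 = y i 0.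
Proof.
move=> ji; rewrite mxE (bigD1 i)//= big1 => [|h hi].
  by rewrite !mxE ji eqxx mul1r addr0.
by rewrite !mxE ji eqSS [_ == _ :> nat]eq_sym val_eqE (negbTE hi) mul0r.
Qed.

Lemma Irmx_proj : Ir^T *m Ir =
  1%:M - \matrix_(i, j) ((i == 0%N :> nat) && (j == 0%N :> nat))%:R.
Proof.
apply/matrixP => i j; rewrite !mxE.
case: (posnP i) => i0.
  rewrite big1 => [|h _]; last by rewrite !mxE i0 mul0r.
  by rewrite -val_eqE/= i0 [in (0 == _)%N]eq_sym subrr.
have ilt : (i.-1 < n.-1)%N by rewrite -ltnS !prednK.
rewrite (bigD1 (Ordinal ilt))//= big1 => [|h hi].
  by rewrite !mxE/= prednK// eqxx mul1r addr0 mulr0n subr0 -val_eqE eq_sym.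
rewrite !mxE; suff -> : (i == h.+1 :> nat) = false by rewrite mul0r.
by apply: contraNF hi => /eqP ih; apply/eqP/val_inj; rewrite /= ih.
Qed.

Let S := invmx T *m Ir^T.

(** The projection onto vectors of mean zero: [Ir^T *m Ir] drops the first coordinate, which [T]
    sends the mean to, and [T] maps the constant vector onto that coordinate axis. *)
Lemma mul_S_IrT : S *m (Ir *m T) = 1%:M - n%:R^-1 *: const_mx 1.
Proof.
rewrite /S -mulmxA [Ir^T *m _]mulmxA Irmx_proj mulmxBl mul1mx mulmxBr.
rewrite mulVmx ?Tmx_unit//; congr (_ - _).
apply: (can_inj (mulKmx Tmx_unit)); rewrite mulKVmx ?Tmx_unit// -scalemxAr.
apply/matrixP => i j; rewrite [RHS]mxE.
have -> : (T *m const_mx 1) i j = (i == 0%N :> nat)%:R.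
  have := congr1 (fun y : 'cV_n => y i 0) Tmx_const; rewrite [RHS]mxE => <-.
  by rewrite !mxE; apply: eq_bigr => k _; rewrite !mxE.
rewrite mxE (bigD1 (Ordinal n_gt0))//= big1 => [|k k0].
  by rewrite !mxE/= andbT addr0 mulrC.
rewrite !mxE; suff -> : (k == 0%N :> nat) = false by rewrite andbF mul0r.
by apply: contraNF k0 => /eqP k0; apply/eqP/val_inj.
Qed.

(** If [S *m y] is constant, then [Ir^T *m y] is a multiple of the first basis vector, whereas the
    entries of [y] sit in the other positions. *)
Lemma S_const_inj (y : 'cV[R]_n.-1) :
  (forall i j, (S *m y) i 0 = (S *m y) j 0) -> y = 0.
Proof.
move=> Syc; pose c := (S *m y) (Ordinal n_gt0) 0.
have SE : S *m y = c *: const_mx 1.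
  by apply/colP => i; rewrite !mxE mulr1; have := Syc i (Ordinal n_gt0); rewrite [LHS]mxE.
have TS : Ir^T *m y = c *: (T *m const_mx 1).
  by rewrite scalemxAr -SE mulmxA mulKVmx// Tmx_unit.
apply/colP => i; rewrite mxE.
have ilt : (i.+1 < n)%N by rewrite -ltn_predRL.
rewrite -(@Irmx_col y i (Ordinal ilt))// TS Tmx_const !mxE/=.
by rewrite mulr0.
Qed.

End Coordinates.

(** * Negative definiteness of the fast block *)

Section FastBlock.
Context {R : realType} (n : nat) (G : microgrid R n).
Hypothesis n_gt0 : (0 < n)%N.
Hypothesis nbr_sym : symmetric (nbr G).
Hypothesis nbr_conn : forall i j : 'I_n, connect (nbr G) i j.
Hypothesis tau_v_gt0 : 0 < tau_v G.
Hypothesis k_gt0 : 0 < kgain G.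

Let L : 'M[R]_n := laplacian (nbr G).
Let S : 'M[R]_(n, n.-1) := invmx (Tmx n) *m (Irmx n)^T.

(** The weight of the fast variable: its form is the squared Euclidean norm of [S *m y], the
    deviation in node coordinates. *)
Definition fast_gram : 'M[R]_n.-1 := S^T *m S.

Lemma fast_gram_sym : fast_gram^T = fast_gram.
Proof. by rewrite trmx_mul trmxK. Qed.

Lemma fast_gram_posdef y : y != 0 -> 0 < bil fast_gram y y.
Proof.
move=> y0; have -> : bil fast_gram y y = bil 1%:M (S *m y) (S *m y).
  by rewrite [RHS]bilM mul1mx [RHS]bilMl.
apply: bil1_gt0; apply: contra y0 => /eqP Sy; apply/eqP.
by apply: (S_const_inj n_gt0) => i j; rewrite -/S Sy !mxE.
Qed.

(** [S *m Ir *m T] differs from the identity by a multiple of the all-ones matrix, which [L]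
    annihilates. *)
Lemma fast_gram_Rzeta :
  fast_gram *m Rzeta G = - ((tau_v G)^-1 *: (S^T *m L *m Kmx G *m L *m S)).
Proof.
have JL : (n%:R^-1 *: const_mx 1 : 'M[R]_n) *m L = 0.
  rewrite -scalemxAl; apply/eqP; rewrite scaler_eq0; apply/orP; right; apply/eqP.
  apply: (can_inj (@trmxK _ _ _)); rewrite trmx_mul trmx0 laplacian_sym//.
  by rewrite trmx_const laplacian_const.
rewrite /Rzeta mulmxN -scalemxAr; congr (- (_ *: _)).
rewrite /fast_gram -!mulmxA; congr (_ *m _); rewrite !mulmxA -/S.
rewrite -[S *m Irmx n *m Tmx n]mulmxA mul_S_IrT//.
by rewrite mulmxBl mul1mx JL subr0 -!mulmxA.
Qed.

(** The form is a negative multiple of that of [Kmx] at [L *m S *m y]. If this vector vanishes,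
    connectedness makes [S *m y] constant, so [y = 0]. *)
Lemma fast_gram_Rzeta_neg y : y != 0 -> bil (fast_gram *m Rzeta G) y y < 0.
Proof.
move=> y0; rewrite fast_gram_Rzeta bilN bilZ oppr_lt0 mulr_gt0 ?invr_gt0//.
have -> : bil (S^T *m L *m Kmx G *m L *m S) y y =
    bil (Kmx G) (L *m S *m y) (L *m S *m y).
  have Lsym : L^T = L by exact: laplacian_sym.
  by rewrite [RHS]bilMl [RHS]bilM [(L *m S)^T]trmx_mul Lsym !mulmxA.
apply: invmx_resolvent_posdef => //; apply: contra y0 => /eqP LSy.
apply/eqP/(S_const_inj n_gt0); apply: (laplacian_ker nbr_sym) => //.
by rewrite mulmxA.
Qed.

Lemma Rzeta_unit : Rzeta G \in unitmx.
Proof.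
apply: unitmx_ker0 => y Ry; apply/eqP/negPn/negP => /fast_gram_Rzeta_neg.
by rewrite -bilM Ry /bil mulmx0 mxE ltxx.
Qed.

End FastBlock.

(** * Saturation and leakage as scalar functions *)

Section Nonlinearities.
Context {R : realType}.

(** The square of the hyperbolic secant, in a form whose positivity is evident. *)
Lemma is_derive_tanh (x : R) :
  is_derive x 1 tanh (4 / (expR x + expR (- x)) ^+ 2).
Proof.
have D0 : expR x + expR (- x) != 0 by rewrite gt_eqF// addr_gt0 ?expR_gt0.
have dN : is_derive x 1 (fun y : R => expR (- y)) (- expR (- x)).
  have := @is_derive1_comp R expR (fun y => - y) x _ _ (is_derive_expR (- x))
    (is_deriveN (is_derive_id x 1)).
  by move=> h; apply: is_derive_eq h _; rewrite mulrN mulr1.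
have dA := is_deriveB (is_derive_expR x) dN.
have dB := is_deriveD (is_derive_expR x) dN.
have D0' : (expR \+ (fun y : R => expR (- y))) x != 0 by [].
have dV := is_deriveV D0' dB.
have -> : @tanh R = (expR - (fun y => expR (- y))) *
    (fun y => ((expR \+ (fun y => expR (- y))) y)^-1) by [].
have := is_deriveM dA dV.
move=> h; apply: is_derive_eq h _.
rewrite /GRing.scale/= /GRing.add/= -[X in X = _]/((expR x - expR (- x)) *
  (- (expR x + expR (- x)) ^- 2 * (expR x - expR (- x))) +
  (expR x + expR (- x))^-1 * (expR x - - expR (- x))).
have ab : expR x * expR (- x) = 1 by rewrite expRN mulfV// gt_eqF// expR_gt0.
have -> : 4 / (expR x + expR (- x)) ^+ 2 =
    4 * (expR x * expR (- x)) / (expR x + expR (- x)) ^+ 2 by rewrite ab mulr1.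
by move: (expR x) (expR (- x)) D0 => a b D0; field.
Qed.

Lemma derive_gt0_homo (f : R -> R) :
  (forall x : R, exists2 s, 0 < s & is_derive x 1 f s) -> {homo f : x y / x < y}.
Proof.
move=> df x y xy.
apply: (@gtr0_derive1_lt_cc R f x y) => //; rewrite ?in_itv/= ?lexx ?(ltW xy)//.
- by move=> z _; have [s _ []] := df z.
- by move=> z _; have [s s0 [_]] := df z; rewrite derive1E => ->.
- apply: derivable_within_continuous => z _; by have [s _ []] := df z.
Qed.

Lemma derive_gt0_continuous (f : R -> R) :
  (forall x : R, exists2 s, 0 < s & is_derive x 1 f s) -> continuous f.
Proof.
move=> df x; have [s _ [fx _]] := df x.
by apply: differentiable_continuous; exact/derivable1_diffP.
Qed.

Definition voltage (c D s : R) : R := c + D * tanh (s / D).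

Lemma voltage_derive (c D v : R) : 0 < D ->
  exists2 s, 0 < s & is_derive v 1 (voltage c D) s.
Proof.
move=> D0; exists (4 / (expR (v / D) + expR (- (v / D))) ^+ 2).
  by rewrite divr_gt0// exprn_gt0// addr_gt0 ?expR_gt0.
have dd : is_derive v 1 (fun s : R => s / D) D^-1.
  have -> : (fun s : R => s / D) = D^-1 *: id by apply/funext => s; exact: mulrC.
  by apply: is_derive_eq (is_deriveZ _ (is_derive_id v 1)) _; exact: mulr1.
have dt := @is_derive1_comp R tanh (fun s : R => s / D) v _ _ (is_derive_tanh _) dd.
have -> : voltage c D = cst c + D *: (tanh \o (fun s => s / D)) by [].
apply: is_derive_eq (is_deriveD (is_derive_cst c v 1) (is_deriveZ D dt)) _.
by rewrite add0r /GRing.scale/= mulrC divfK// gt_eqF.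
Qed.

Definition leakage (D s : R) : R :=
  (if 3 * D < `|s| then `|s / D| - 3 else 0) * s.

(** The threshold test is a positive part; in this form continuity at [3 * D] is visible. *)
Lemma leakageE (D s : R) : 0 < D -> leakage D s = Num.max 0 (`|s| / D - 3) * s.
Proof.
move=> D0; rewrite /leakage normrM normfV (gtr0_norm D0); congr (_ * _).
have -> : (3 * D < `|s|) = (0 < `|s| / D - 3) by rewrite subr_gt0 ltr_pdivlMr.
by rewrite /Num.max/Order.max; case: ifP.
Qed.

Lemma leakage_homo (D : R) : 0 < D -> {homo leakage D : x y / x <= y}.
Proof.
move=> D0 x y xy; rewrite !leakageE//.
have m0 z : 0 <= Num.max 0 (`|z| / D - 3) by rewrite le_max lexx.
have m_le z w : `|z| <= `|w| ->
    Num.max 0 (`|z| / D - 3) <= Num.max 0 (`|w| / D - 3).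
  move=> zw; rewrite ge_max m0 le_max lerD2r ler_pM2r ?invr_gt0//.
  by rewrite zw orbT.
have [x0|x0] := leP 0 x.
  by rewrite ler_pM// m_le// !ger0_norm// (le_trans x0).
have [y0|y0] := leP 0 y.
  by apply: (@le_trans _ _ 0); [rewrite mulr_ge0_le0// ltW|rewrite mulr_ge0].
rewrite -lerN2 -!mulrN ler_pM ?oppr_ge0 ?(ltW y0) ?lerN2//.
by rewrite m_le// !ltr0_norm// lerN2.
Qed.

Lemma leakage_up (D c : R) : 0 < D -> exists2 v, 0 <= v & c <= leakage D v.
Proof.
move=> D0; have c0 := normr_ge0 c; have v0 : 0 <= 4 * D + `|c| by lra.
(* Beyond [4 * D] the leakage coefficient is at least [1], so the leakage is at least its
   argument. *)
exists (4 * D + `|c|) => //; rewrite leakageE// ger0_norm//.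
apply: (le_trans (ler_norm c)); apply: (@le_trans _ _ (4 * D + `|c|)); first by lra.
rewrite ler_peMl// le_max; apply/orP; right.
by rewrite lerBrDr ler_pdivlMr//; lra.
Qed.

Lemma leakage_down (D c : R) : 0 < D -> exists2 v, v <= 0 & leakage D v <= c.
Proof.
move=> D0; have [v v0 cv] := leakage_up (- c) D0.
exists (- v); first by rewrite oppr_le0.
by move: cv; rewrite !leakageE// normrN mulrN lerNl.
Qed.

(** A product estimate: within distance [1] of [v] the coefficient is at most [(|v| + 1) / D], and
    it is Lipschitz with constant [1 / D]. *)
Lemma leakage_lip (D v : R) : 0 < D -> exists2 L, 0 < L &
  forall w, `|w - v| <= 1 -> `|leakage D w - leakage D v| <= L * `|w - v|.
Proof.
move=> D0; have v0 := normr_ge0 v.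
exists ((2 * `|v| + 1) / D) => [|w wv]; first by rewrite divr_gt0//; lra.
rewrite !leakageE//; set a := `|w| / D - 3; set b := `|v| / D - 3.
have nwv := ler_dist_dist w v.
have ab : `|Num.max 0 a - Num.max 0 b| <= `|w - v| / D.
  apply: (@le_trans _ _ `|a - b|).
    have n1 := ler_norm (a - b); have n2 := ler_norm (b - a).
    rewrite distrC in n2; have [a0|a0] := leP 0 a; have [b0|b0] := leP 0 b => //.
    - by rewrite subr0 ger0_norm//; lra.
    - by rewrite sub0r normrN ger0_norm//; lra.
    - by rewrite subrr normr0.
  have -> : a - b = (`|w| - `|v|) / D by rewrite /a /b; field; rewrite gt_eqF.
  by rewrite normrM normfV (gtr0_norm D0) ler_pM2r ?invr_gt0.
have wv1 : `|w| <= `|v| + 1.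
  have : `|w| <= `|w - v| + `|v| by rewrite -{1}(subrK v w) ler_normD.
  lra.
have a1 : `|Num.max 0 a| <= (`|v| + 1) / D.
  have vD0 : 0 <= (`|v| + 1) / D by apply: divr_ge0; [lra|exact: ltW].
  rewrite ger0_norm ?le_max ?lexx// ge_max vD0/=.
  have : `|w| / D <= (`|v| + 1) / D by rewrite ler_pM2r ?invr_gt0.
  rewrite /a; lra.
have -> : Num.max 0 a * w - Num.max 0 b * v =
  Num.max 0 a * (w - v) + (Num.max 0 a - Num.max 0 b) * v by ring.
apply: le_trans (ler_normD _ _) _; rewrite !normrM.
have h1 : `|Num.max 0 a| * `|w - v| <= (`|v| + 1) / D * `|w - v|.
  by rewrite ler_wpM2r.
have h2 : `|Num.max 0 a - Num.max 0 b| * `|v| <= `|w - v| / D * `|v|.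
  by rewrite ler_wpM2r.
apply: le_trans (lerD h1 h2) _; rewrite le_eqVlt; apply/orP; left; apply/eqP.
by field; rewrite gt_eqF.
Qed.

Lemma leakage_continuous (D : R) : 0 < D -> continuous (leakage D).
Proof.
move=> D0 v; have [L L0 hL] := leakage_lip v D0.
apply/cvgrPdist_le => e e0; near=> w; rewrite distrC.
apply: (@le_trans _ _ (L * `|w - v|)).
  apply: hL; rewrite distrC; near: w; exact: cvgr_dist_le.
rewrite -ler_pdivlMl// mulrC distrC; near: w.
by apply: cvgr_dist_le; rewrite // divr_gt0.
Unshelve. all: by end_near. Qed.

End Nonlinearities.

(** * The closed loop as an instance of the fast-slow system *)

Section ClosedLoop.
Context {R : realType} (n : nat) (G : microgrid R n).
Hypothesis V_lim : forall i, 0 < V_min G i 0 < V_max G i 0.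

Lemma Delta_gt0 i : 0 < Delta G i 0.
Proof.
by have /andP[_ h] := V_lim i; rewrite !mxE mulr_gt0 ?invr_gt0// subr_gt0.
Qed.

Let sig i := voltage (Vstar G i 0) (Delta G i 0).
Let phi i := leakage (Delta G i 0).

Lemma VofE v : Vof G v = colmap sig v.
Proof.
have Du : diag_of (Delta G) \in unitmx.
  apply: unitmx_form => x x0; rewrite gt_eqF// bil_diag_gt0// => i.
  by rewrite mxE Delta_gt0.
have DV i : (invmx (diag_of (Delta G)) *m v) i 0 = v i 0 / Delta G i 0.
  have := congr1 (fun y : 'cV_n => y i 0) (mulKVmx Du v).
  rewrite mul_diag_mx mxE [X in X * _]mxE => <-.
  by rewrite mulrC mulKf// gt_eqF// Delta_gt0.
apply/colP => i; rewrite [LHS]mxE mul_diag_mx.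
by rewrite [X in _ + X]mxE [X in _ + X * _]mxE [X in _ + _ * X]mxE DV [RHS]mxE.
Qed.

Lemma rhoE v : rho G v *m v = colmap phi v.
Proof. by apply/colP => i; rewrite mul_diag_mx !mxE. Qed.

Lemma closed_loopE tau_d : closed_loop G tau_d =
  fast_slow (Rtheta G) (RthetaV G) (Rvtheta G) (RvV G - (beta G)%:M) (Rvzeta G)
    (Rzetatheta G) (RzetaV G) (Rzeta G) (dtheta G) (dv G) (dzeta G) sig phi
    (tau_v G) (tau_d / tau_v G).
Proof. by apply/funext => -[[r v] z]; rewrite /closed_loop VofE rhoE. Qed.

End ClosedLoop.

Theorem theorem1 (R : realType) (n : nat) (G : microgrid R n)
    (Ptheta : 'M[R]_n.-1) (Dv : 'M[R]_n)
    (n_ge2 : (2 <= n)%N)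
    (nbr_sym : symmetric (nbr G)) (nbr_irr : irreflexive (nbr G))
    (nbr_conn : forall i j : 'I_n, connect (nbr G) i j)
    (tau_v_gt0 : 0 < tau_v G) (beta_gt0 : 0 < beta G) (k_gt0 : 0 < kgain G)
    (m_gt0 : forall i, 0 < m_omega G i 0)
    (S_gt0 : forall i, 0 < S_rated G i 0)
    (V_lim : forall i, 0 < V_min G i 0 < V_max G i 0)
    (JP1 : JPtheta G *m (const_mx 1 : 'cV[R]_n) = 0)
    (JQ1 : JQtheta G *m (const_mx 1 : 'cV[R]_n) = 0)
    (Dv_diag : is_diag_mx Dv)
    (Ptheta_pos : posdefmx Ptheta)
    (Dv_pos : posdefmx Dv)
    (Q_neg : negdefmx (Qmx G Ptheta Dv + (Qmx G Ptheta Dv)^T)) :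
  exists2 eps_star : R, 0 < eps_star &
    forall tau_d : R, 0 < tau_d -> tau_d < eps_star * tau_v G ->
      exists2 xbar : 'cV[R]_n.-1 * 'cV[R]_n * 'cV[R]_n.-1,
        (forall x, equilibrium (closed_loop G tau_d) x <-> x = xbar) &
        exponentially_stable (closed_loop G tau_d) xbar.
Proof.
have n_gt0 : (0 < n)%N by exact: leq_trans n_ge2.
have D0 i := Delta_gt0 V_lim i.
have [Psym Ppos] := Ptheta_pos.
have /is_diag_mxP Dv_off := Dv_diag.
pose d : 'rV[R]_n := \row_i Dv i i.
have DvE : Dv = diag_mx d.
  apply/matrixP => i j; rewrite !mxE; have [->|ij] := eqVneq i j.
    by rewrite mulr1n.
  by rewrite mulr0n Dv_off.
(* Positive definiteness is tested on the basis vectors. *)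
have d_gt0 i : 0 < d 0 i.
  have e0 : delta_mx i 0 != 0 :> 'cV[R]_n.
    apply/eqP => /(congr1 (fun x : 'cV_n => x i 0)).
    by rewrite !mxE !eqxx => /eqP; rewrite oner_eq0.
  have := (proj2 Dv_pos) _ e0; rewrite -/(bil _ _ _) DvE bil_diag.
  rewrite (bigD1 i)//= big1 => [|j /negbTE ji]; rewrite !mxE ?ji ?eqxx/=.
    by rewrite !mulr1 addr0.
  by rewrite mul0r mulr0.
(* The forms of [Q] and of its transpose agree, so that of the symmetrized matrix is twice that of
   [Q]. *)
have Qneg x : x != 0 -> bil (block_mx (Ptheta *m Rtheta G) (Ptheta *m RthetaV G)
    (diag_mx d *m (Rvtheta G - Rvzeta G *m invmx (Rzeta G) *m Rzetatheta G))
    (diag_mx d *m (RvV G - (beta G)%:M - Rvzeta G *m invmx (Rzeta G) *m RzetaV G)))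
    x x < 0.
  move=> /(proj2 Q_neg); rewrite -/(bil _ x x) bilA bil_tr -DvE.
  rewrite [RvV G - _ - _]addrAC -/(RvV_new G) -/(Rvtheta_new G) -/(Qmx G Ptheta Dv).
  lra.
have Zu : Rzeta G \in unitmx by exact: Rzeta_unit.
have sig_derive (i : 'I_n) (v : R) := voltage_derive (Vstar G i 0) v (D0 i).
(* The equilibrium is obtained before [tau_d] is introduced and serves all its values. *)
have [xbar xbarP] := fast_slow_equilibrium (dtheta G) (dv G) (dzeta G)
  (fun i => derive_gt0_continuous (sig_derive i))
  (fun i => derive_gt0_homo (sig_derive i))
  (fun i => leakage_continuous (D0 i)) (fun i => leakage_homo (D0 i))
  (fun i c => leakage_up c (D0 i)) (fun i c => leakage_down c (D0 i))
  tau_v_gt0 Psym Ppos d_gt0 Qneg Zu.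
have [es es0 hes] := fast_slow_stable sig_derive (fun i => leakage_homo (D0 i))
  (fun i v => leakage_lip v (D0 i)) tau_v_gt0 Psym Ppos d_gt0 Qneg Zu
  (fast_gram_sym n) (fast_gram_posdef n_gt0)
  (fast_gram_Rzeta_neg n_gt0 nbr_sym nbr_conn tau_v_gt0 k_gt0)
  (fun eps eps0 => (xbarP eps xbar eps0).2 erefl).
exists es => // tau_d td0 tdlt; exists xbar.
  move=> x; rewrite /equilibrium closed_loopE//; apply: xbarP.
  by rewrite divr_gt0.
rewrite closed_loopE//; apply: hes.
by rewrite divr_gt0//= ltr_pdivrMr.
Qed.
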